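(* Let $\sigma\ge m>d/2$, $s\ge\sigma$ and $0<\rho_0<1$. Let $\{\boldsymbol\varepsilon_j\}_{j=1}^N$ be independent zero-mean random variables (noises) satisfying $|\boldsymbol\varepsilon_j|\le M_{\boldsymbol\varepsilon}$ with $M_{\boldsymbol\varepsilon}>0$. Suppose the scaled zonal kernels $\varphi_\rho$ satisfy, with constants $c_1,c_2>0$ and $0<c_3\le c_4<\infty$ independent of $\ell$ and $\rho$, for all $0<\rho<\rho_0$: (i) $|1-\widehat{\varphi_\rho}(\ell)|\le c_1\ell^m\rho^m$ for $0\le\ell\le\ell_\rho:=\lfloor\rho^{-1}-1\rfloor$; (ii) $\widehat{\varphi_\rho}(\ell)\le c_2$ for $\ell>\ell_\rho$; (iii) $c_3(1+\rho\ell)^{-2s}\le\widehat{\varphi_\rho}(\ell)\le c_4(1+\rho\ell)^{-2s}$ for all $\ell>0$. Let $f\in H^\sigma(\mathbb S^d)$, let $\{x_1,\dots,x_N\}\subset\mathbb S^d$ be a QMC design for $H^\sigma(\mathbb S^d)$, and let $$\mathcal Q^{q,\boldsymbol\varepsilon}_{\varphi_\rho}f(x)=\frac1N\sum_{j=1}^N\big(f(x_j)+\boldsymbol\varepsilon_j\big)\varphi_\rho(x\cdot x_j),\qquad x\in\mathbb S^d.$$ There is a constant $C_4>0$ independent of $\rho$ and $N$ such that the following holds. For any $\epsilon>0$, let $\rho\in(0,\rho_0)$ and $N$ be chosen such that $$C_4\big(\rho^m+\rho^{-d/2}N^{-1/2}\big)\big(\|f\|_{H^\sigma}+M_{\boldsymbol\varepsilon}\big)\le\frac\epsilon2.$$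 Then there exists a constant $C>0$ independent of $\rho$ and $N$ such that $$\mathbb P\big\{\|\mathcal Q^{q,\boldsymbol\varepsilon}_{\varphi_\rho}f-f\|_{L_2}\ge\epsilon\big\}\le2\exp\big(-C\rho^dN\epsilon^2M_{\boldsymbol\varepsilon}^{-2}\big).$$
   Context: $\mathbb S^d=\{x\in\mathbb R^{d+1}:\|x\|=1\}$ and $\mu$ is the rotationally invariant measure on $\mathbb S^d$, normalized so that $\mu(\mathbb S^d)=1$; $L_2=L_2(\mathbb S^d,\mu)$. $\{\mathcal Y_{\ell,k}:k=1,\dots,Z(d,\ell),\ \ell\ge0\}$ is an orthonormal basis of $L_2$ of spherical harmonics ($\mathcal Y_{\ell,k}$ of degree $\ell$; $Z(d,\ell)$ the dimension of the degree-$\ell$ space). $\widehat f_{\ell,k}=\int f\,\overline{\mathcal Y_{\ell,k}}\,d\mu$, and $H^\sigma(\mathbb S^d)$ is the space of $f\in L_2$ with $\|f\|_{H^\sigma}^2=\sum_{\ell,k}(1+\ell)^{2\sigma}|\widehat f_{\ell,k}|^2<\infty$. Scaled zonal kernel: let $\phi\in C[0,\infty]$, $\Phi_\rho(x)=\phi(\rho^{-1}\|x\|)$ on $\mathbb R^{d+1}$, $0<\rho<1$. Then $\varphi_\rho(x\cdot y)=\Lambda_{\phi,\rho}^{-1}\Phi_\rho(x-y)$ for $x,y\in\mathbb S^d$, where $\Lambda_{\phi,\rho}=\int_{\mathbb S^d}\Phi_\rho(x-y)\,d\mu(x)$. Its Fourier–Legendre coefficients are defined by $\varphi_\rho(x\cdot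 y)=\sum_{\ell\ge0}\widehat{\varphi_\rho}(\ell)\sum_{k=1}^{Z(d,\ell)}\mathcal Y_{\ell,k}(x)\mathcal Y_{\ell,k}(y)$. QMC designs: for $\sigma>d/2$, a sequence of $N$-point sets $\{x_1,\dots,x_N\}\subset\mathbb S^d$ is a (sequence of) QMC design(s) for $H^\sigma(\mathbb S^d)$ if there is $C(\sigma,d)>0$ independent of $N$ such that $\big|\frac1N\sum_{j=1}^Ng(x_j)-\int_{\mathbb S^d}g\,d\mu\big|\le C(\sigma,d)N^{-\sigma/d}\|g\|_{H^\sigma}$ for all $g\in H^\sigma(\mathbb S^d)$. *)

(* Defs.v *)
From HB Require Import structures.
From mathcomp Require Import all_boot all_order all_algebra.
From mathcomp Require Import all_classical all_reals all_analysis.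
From mathcomp Require Import (canonicals, coercions) mpoly.

Set Implicit Arguments.
Unset Strict Implicit.
Unset Printing Implicit Defensive.

Import Order.TTheory GRing.Theory Num.Theory.
Import numFieldNormedType.Exports.

Local Open Scope classical_set_scope.
Local Open Scope ring_scope.

(* Functions on the sphere S^d are represented by functions on the ambient
   R^(d+1); every notion below only looks at their values on the sphere. *)

(* The library norm on 'rV[R]_n is the sup norm, hence this one. *)
Definition enorm (R : realType) (n : nat) (x : 'rV[R]_n) : R :=
  Num.sqrt (\sum_i x ord0 i ^+ 2).

Definition sphere (R : realType) (d : nat) : set 'rV[R]_d.+1 :=
  [set x | enorm x = 1].
Arguments sphere : clear implicits.

Definition borel_rV (R : realType) (n : nat) :=
  g_sigma_algebraType (@open 'rV[R]_n).

(* For d >= 1 this determines mu uniquely. *)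
Definition uniform_on_sphere (R : realType) (d : nat)
    (mu : probability (borel_rV R d.+1) R) : Prop :=
  mu (sphere R d) = 1%E /\
  forall O : 'M[R]_d.+1, O *m O^T = 1%:M -> \det O = 1 ->
  forall A : set (borel_rV R d.+1), measurable A ->
    mu ((fun x : 'rV[R]_d.+1 => x *m O) @^-1` A) = mu A.

Section FunctionsOnSphere.
Context (R : realType) (d : nat) (mu : probability (borel_rV R d.+1) R).
Implicit Types f g : 'rV[R]_d.+1 -> R.

Definition L2norm f : \bar R :=
  ('N[mu]_2%:E[((fun x : borel_rV R d.+1 => (f x)%:E) \_ (sphere R d))])%E.

Definition in_L2 f : Prop :=
  measurable_fun (sphere R d : set (borel_rV R d.+1))
                 (f : borel_rV R d.+1 -> R)
  /\ (L2norm f < +oo)%E.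

Definition inner_L2 f g : R := \int[mu]_(x in sphere R d) (f x * g x).

Definition spherical_harmonic (l : nat) f : Prop :=
  exists p : mpoly.mpoly d.+1 R,
    [/\ p \is mpoly.ishomog1 l (mpoly.mdeg (n := d.+1)),
        \sum_(i < d.+1) mpoly.mderiv i (mpoly.mderiv i p) = 0
      & forall x, sphere R d x -> f x = mpoly.meval (x ord0) p].

Section Basis.
Context (Z : nat -> nat) (Y : forall l : nat, 'I_(Z l) -> 'rV[R]_d.+1 -> R).

Definition fourier_coef f (l : nat) (k : 'I_(Z l)) : R := inner_L2 f (Y k).

(* The second and third items make (Y l k)_k a basis of the space of spherical
   harmonics of degree l, so that Z l is the dimension of that space. *)
Definition spherical_harmonic_basis : Prop :=
  [/\ forall (l : nat) (k : 'I_(Z l)), spherical_harmonic l (Y k),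
      forall (l l' : nat) (k : 'I_(Z l)) (k' : 'I_(Z l')),
        inner_L2 (Y k) (Y k') =
        if (l == l') && (k == k' :> nat) then 1 else 0,
      forall (l : nat) h, spherical_harmonic l h ->
        exists c : 'I_(Z l) -> R,
          forall x, sphere R d x -> h x = \sum_(k < Z l) c k * Y k x
    & forall f, in_L2 f ->
        (fun L : nat => L2norm (fun x =>
           f x - \sum_(l < L) \sum_(k < Z l) fourier_coef f k * Y k x))
        @ \oo --> 0%E].

Definition sobolev_sqnorm (sigma : R) f : \bar R :=
  (\sum_(0 <= l <oo)
    (\sum_(k < Z l)
       (1 + l%:R) `^ (2 * sigma) * `|fourier_coef f k| ^+ 2)%:E)%E.

Definition sobolev_norm (sigma : R) f : R :=
  Num.sqrt (fine (sobolev_sqnorm sigma f)).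

(* Elements of L_2 are classes modulo null sets, whereas point values are used
   below.  For sigma > d/2 each class in H^sigma has exactly one continuous
   representative, and [in_sobolev] selects it. *)
Definition in_sobolev (sigma : R) f : Prop :=
  [/\ in_L2 f, (sobolev_sqnorm sigma f < +oo)%E
    & {within sphere R d, continuous f}].

(* A sequence of point sets: the k-th one has N = n k points. *)
Definition QMC_design (sigma : R) (n : nat -> nat)
    (x : forall k : nat, 'I_(n k) -> 'rV[R]_d.+1) : Prop :=
  [/\ forall k, (0 < n k)%N,
      forall k, injective (x k),
      forall k j, sphere R d (x k j)
    & exists2 C : R, 0 < C & forall k g, in_sobolev sigma g ->
        `|(n k)%:R^-1 * \sum_(j < n k) g (x k j)
          - \int[mu]_(y in sphere R d) g y|
        <= C * (n k)%:R `^ (- (sigma / d%:R)) * sobolev_norm sigma g].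

(* [a l] are the Fourier-Legendre coefficients of the zonal kernel K. *)
Definition fourier_legendre (K : 'rV[R]_d.+1 -> 'rV[R]_d.+1 -> R)
    (a : nat -> R) : Prop :=
  forall x y, sphere R d x -> sphere R d y ->
    (fun L : nat => \sum_(l < L) a l * \sum_(k < Z l) Y k x * Y k y)
    @ \oo --> K x y.

End Basis.

Definition Phi (phi : R -> R) (rho : R) (x : 'rV[R]_d.+1) : R :=
  phi (rho^-1 * enorm x).

(* For y on the sphere the value does not depend on y, by invariance of mu. *)
Definition Lambda (phi : R -> R) (rho : R) (y : 'rV[R]_d.+1) : R :=
  \int[mu]_(x in sphere R d) Phi phi rho (x - y).

(* varphi_rho(x . y), as a function of the two points x and y. *)
Definition zonal_kernel (phi : R -> R) (rho : R) (x y : 'rV[R]_d.+1) : R :=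
  (Lambda phi rho y)^-1 * Phi phi rho (x - y).

Definition noisy_quasi_interpolant (K : 'rV[R]_d.+1 -> 'rV[R]_d.+1 -> R)
    (N : nat) (x : 'I_N -> 'rV[R]_d.+1) (e : 'I_N -> R) f (y : 'rV[R]_d.+1) : R :=
  N%:R^-1 * \sum_(j < N) (f (x j) + e j) * K y (x j).

End FunctionsOnSphere.

Definition continuous_on_0_infty (R : realType) (phi : R -> R) : Prop :=
  {within `[0, +oo[, continuous phi} /\ cvg (phi t @[t --> +oo]).

Definition mutually_independent (d : measure_display) (T : measurableType d)
    (R : realType) (P : probability T R) (I : finType)
    (X : I -> {RV P >-> R}) : Prop :=
  forall (J : {set I}) (B : I -> set R), (forall i, measurable (B i)) ->
    P (\bigcap_(i in [set` J]) (X i @^-1` B i)) =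
    (\prod_(i in J) P (X i @^-1` B i))%E.

(* Main.v *)
Require Import Defs.
From HB Require Import structures.
From mathcomp Require Import all_boot all_order all_algebra.
From mathcomp Require Import all_classical all_reals all_analysis.
From mathcomp Require Import measurable_realfun.
From mathcomp Require Import (canonicals, coercions) mpoly.
From mathcomp Require Import ring lra.

Set Implicit Arguments.
Unset Strict Implicit.
Unset Printing Implicit Defensive.

Import Order.TTheory GRing.Theory Num.Theory.
Import numFieldNormedType.Exports.

Local Open Scope classical_set_scope.
Local Open Scope ring_scope.

(* The error splits as D + sum_j e_j g_j, where D is the noiseless error and
   g_j = N^-1 phi_rho(. x_j).

   Noise. The squared norm of sum_j e_j g_j is a quadratic form in the e_j whose
   Gram matrix is positive with diagonal at most g = O(N^-2 rho^-d).  Revealing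
   the e_j one at a time, q <- q + 2 p_j e_j + G_jj e_j^2 with p_j^2 <= q G_jj
   (Cauchy-Schwarz), so that exp(lam q) with lam ~ 1 / (N M^2 g) is almost a
   supermartingale, and Markov's inequality gives the tail.

   Bias. The (l,k) coefficient of D is phihat(l) err(f Y_lk) + (phihat(l) - 1)
   fhat_lk, with err the quadrature error.  The second part is O(rho^m) by the
   hypotheses on phihat.  The first parts are summed by duality: their weighted
   energy E = sum phihat(l)^2 err(f Y_lk)^2 equals err(f u) for
   u = sum phihat(l)^2 err(f Y_lk) Y_lk, and since H^sigma is an algebra for
   sigma > d/2, ||f u|| <= c rho^-sigma E^(1/2); the QMC property then gives
   E^(1/2) <= c rho^-sigma N^(-sigma/d), which is at most
   c rho^(-d/2) N^(-1/2) when rho^d N >= 1.  When rho^d N < 1 the claimed bound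
   on the probability is at least 1 for C small.

   The algebra property is obtained from truncations: modulo products of
   harmonics of degree < n/2, which have degree < n, the part of f u of degree
   >= n is controlled by the tails of f and u beyond n/2.  Embedding into
   bounded functions needs sum_k Y_lk(x)^2 summed against (1+l)^(-2 sigma): this
   is read off from the diagonal values of the kernels phi_rho, which do not
   depend on x by rotation invariance. *)

(** Duality cannot be replaced by the QMC bound for each product f Y_lk: about rho^-d harmonics
    matter at scale rho, and adding up their separate bounds would lose a factor rho^(-d/2). Testing
    against the single function u costs only the Sobolev norm of u. Since u depends on the point
    set, the product estimate has to be uniform over all finite combinations. As sigma is an
    arbitrary real number, that estimate works with degrees instead of derivatives: summation by
    parts turns the Sobolev weights into tail energies, which are what truncation controls.

    On the noise side only the diagonal of the Gram matrix is bounded, so the quadratic form is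
    measured by its trace, at most N g; this gives its mean the size N M^2 g and fixes the scale of
    lam.

    [C4] is chosen after f and M, so the supremum and the norm of f and M^-1 may enter it; [C] is
    chosen after eps and may shrink with it. *)

(** * Scalar inequalities and weighted sums *)

(** Meant for a mean-zero x: the linear term drops out of the expectation and a bound of Gaussian
    type is left. *)
Lemma expR_le_add_expR_sqr (R : realType) (x : R) :
  expR x <= x + expR (3 * x ^+ 2).
Proof.
have h3 := expR_ge1Dx (3 * x ^+ 2).
(* The threshold 2/3 serves both cases: above it x <= 3 x^2, and below it (1 - x)(1 + x + 3 x^2) = 1
   + x^2 (2 - 3 x) >= 1, where exp x <= 1 / (1 - x). *)
have [x23|x23] := lerP x (2 / 3); last first.
  have xl : x <= 3 * x ^+ 2 by nra.
  have : expR x <= expR (3 * x ^+ 2) by rewrite ler_expR.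
  by move=> h; apply: le_trans h _; lra.
have h1 := expR_ge1Dx (- x); have e0 := expR_gt0 (- x).
have xE : expR x = (expR (- x))^-1 by rewrite expRN invrK.
apply: (@le_trans _ _ ((1 - x)^-1)).
  by rewrite xE lef_pV2 ?posrE //; lra.
apply: (@le_trans _ _ (x + (1 + 3 * x ^+ 2))); last by lra.
rewrite invf_ple ?posrE; [|lra|nra].
rewrite -[X in X <= _]mul1r ler_pdivrMr; last by nra.
have x2 : 0 <= x ^+ 2 by exact: sqr_ge0.
have -> : (1 - x) * (x + (1 + 3 * x ^+ 2)) = 1 + x ^+ 2 * (2 - 3 * x) by ring.
by rewrite lerDl mulr_ge0 //; lra.
Qed.

Definition increment (V : zmodType) (w : nat -> V) (i : nat) : V :=
  w i - (if i is j.+1 then w j else 0).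

Lemma sum_increment (V : zmodType) (w : nat -> V) (n : nat) :
  \sum_(i < n.+1) increment w i = w n.
Proof.
elim: n => [|n IH]; first by rewrite big_ord_recr big_ord0 /= add0r /increment subr0.
by rewrite big_ord_recr /= IH /increment addrC subrK.
Qed.

(** For a nondecreasing nonnegative weight this is a positive combination of tails of c, so a bound
    on the tails suffices. *)
Lemma sum_mul_Abel (R : comNzRingType) (w c : nat -> R) (n : nat) :
  \sum_(L < n) w L * c L =
  \sum_(i < n) increment w i * \sum_(i <= L < n) c L.
Proof.
elim: n => [|n IH]; first by rewrite !big_ord0.
rewrite big_ord_recr /= IH -[in w n](sum_increment w n) !big_ord_recr /=.
rewrite big_nat1 mulrDl addrA mulr_suml -big_split /=; congr (_ + _).
apply: eq_bigr => i _; rewrite -mulrDr big_nat_recr //=; exact: ltnW.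
Qed.

Lemma ler_powRN (R : realType) (x y t : R) :
  0 < x -> x <= y -> 0 <= t -> y `^ (- t) <= x `^ (- t).
Proof.
move=> x0 xy t0; have y0 := lt_le_trans x0 xy.
by rewrite !powRN lef_pV2 ?posrE ?powR_gt0 // ge0_ler_powR // nnegrE ltW.
Qed.

Lemma powRN_le1 (R : realType) (x t : R) : 1 <= x -> 0 <= t -> x `^ (- t) <= 1.
Proof. by move=> x1 t0; apply: le_trans (ler_powRN ltr01 x1 t0) _; rewrite powR1. Qed.

(* Dyadic blocks [l <= 2^j / rho]: the j-th one contributes at most
   [2^(- j tau) * (2^(j+1) / rho)^d] up to a constant. *)
Lemma sum_weight_le (R : realType) (d : nat) (tau C : R) :
  0 <= C -> d%:R < tau ->
  exists2 B : R, 0 < B & forall (rho : R) (a : nat -> R), 0 < rho <= 1 ->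
    (forall l, 0 <= a l) ->
    (forall n, (0 < n)%N -> \sum_(l < n) a l <= C * n%:R ^+ d) ->
    forall n, \sum_(l < n) (1 + rho * l%:R) `^ (- tau) * a l
              <= B * rho^-1 ^+ d.
Proof.
move=> C0 dtau.
(* Ratio of consecutive block bounds: the count of terms grows by 2^d while the weight falls by
   2^(-tau). *)
pose q : R := 2 `^ (d%:R - tau).
have q0 : 0 < q by rewrite powR_gt0.
have q1 : q < 1.
  rewrite /q -opprB powRN invf_lt1 ?powR_gt0 //.
  rewrite -[X in X < _]/((fun=> 1) (tau - d%:R)) -powR1.
  by apply: gt0_ltr_powR; rewrite ?subr_gt0 ?nnegrE // ltr1n.
have geoq J : \sum_(j < J) q ^+ j <= (1 - q)^-1.
  have : (1 - q) * \sum_(j < J) q ^+ j = 1 - q ^+ J.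
    by rewrite -[in RHS](expr1n R J) subrXX; congr (_ * _); apply: eq_bigr => i _;
       rewrite expr1n mul1r.
  move=> h; rewrite -(ler_pM2l (x := 1 - q)) ?subr_gt0 // h mulfV ?gt_eqF ?subr_gt0 //.
  by rewrite gerBl exprn_ge0 // ltW.
(* The initial block gives C 2^d, the geometric series the remaining product; the final 1 keeps the
   constant positive when C = 0. *)
exists (C * 2 ^+ d * (1 + 2 ^+ d * (1 - q)^-1) + 1).
  rewrite ltr_wpDl // !mulr_ge0 ?exprn_ge0 // addr_ge0 // mulr_ge0 ?exprn_ge0 //.
  by rewrite invr_ge0 subr_ge0 ltW.
move=> rho a /andP[r0 r1] a0 ha.
(* Least integer exceeding 2^j / rho; as rho <= 1 it is at most twice that number. *)
pose nn j := (Num.trunc (2 ^+ j * rho^-1 : R)).+1.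
have nnlt j l : (nn j <= l)%N -> 2 ^+ j < rho * l%:R.
  move=> h; have p : 0 <= 2 ^+ j * rho^-1 :> R by rewrite mulr_ge0 ?exprn_ge0 ?invr_ge0 // ltW.
  have /andP[_ h2] := truncn_itv p.
  rewrite mulrC -ltr_pdivrMr //; apply: lt_le_trans h2 _.
  by rewrite ler_nat.
have nnle j : (nn j)%:R <= 2 * 2 ^+ j * rho^-1 :> R.
  have p : 0 <= 2 ^+ j * rho^-1 :> R by rewrite mulr_ge0 ?exprn_ge0 ?invr_ge0 // ltW.
  have /andP[h2 _] := truncn_itv p.
  have : 1 <= 2 ^+ j * rho^-1 :> R.
    by rewrite mulr_ege1 // ?exprn_ege1 ?invf_ge1 //; lra.
  rewrite /nn -natr1; move: h2; lra.
have nnmono j : (nn j <= nn j.+1)%N.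
  rewrite ltnS; apply: le_truncn; rewrite ler_pM2r ?invr_gt0 // exprS.
  by rewrite ler_peMl ?exprn_ge0 //; lra.
have blk J : \sum_(l < nn J) (1 + rho * l%:R) `^ (- tau) * a l <=
   C * 2 ^+ d * rho^-1 ^+ d * (1 + 2 ^+ d * \sum_(j < J) q ^+ j).
  elim: J => [|J IH].
    rewrite big_ord0 mulr0 addr0 mulr1.
    apply: (@le_trans _ _ (\sum_(l < nn 0%N) a l)).
      apply: ler_sum => l _; rewrite ler_piMl //.
      by rewrite powRN_le1 ?(le_trans _ (ltW dtau)) // lerDl mulr_ge0 // ltW.
    apply: le_trans (ha _ _) _ => //.
    rewrite -!mulrA ler_wpM2l // -exprMn lerXn2r ?nnegrE ?mulr_ge0 ?invr_ge0 ?(ltW r0)//.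
    by have := nnle 0%N; rewrite expr0 mulr1.
  rewrite -(big_mkord xpredT (fun l => (1 + rho * l%:R) `^ (- tau) * a l)).
  rewrite (@big_cat_nat _ _ _ (nn J)) //= big_mkord (big_ord_recr J) /= (mulrDr (2 ^+ d)) addrA mulrDr.
  apply: lerD => //.
  apply: (@le_trans _ _ (\sum_(nn J <= l < nn J.+1) (2 ^+ J) `^ (- tau) * a l)).
    apply: ler_sum_nat => l /andP[h _]; apply: ler_wpM2r => //.
    rewrite ler_powRN ?exprn_gt0 ?(le_trans _ (ltW dtau)) //.
    by have := nnlt _ _ h; lra.
  rewrite -mulr_sumr.
  apply: (@le_trans _ _ ((2 ^+ J) `^ (- tau) * (C * (2 * 2 ^+ J.+1 * rho^-1) ^+ d))).
    apply: ler_wpM2l; first exact: powR_ge0.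
    apply: (@le_trans _ _ (\sum_(l < nn J.+1) a l)).
      rewrite -[leRHS](big_mkord xpredT a) [leRHS](@big_cat_nat _ _ _ (nn J)) //=.
      by rewrite lerDr sumr_ge0.
    apply: le_trans (ha _ _) _ => //.
    rewrite ler_wpM2l // lerXn2r ?nnegrE ?mulr_ge0 ?exprn_ge0 ?invr_ge0 ?(ltW r0)//.
  rewrite le_eqVlt; apply/orP; left; apply/eqP.
  have -> : q ^+ J = (2 ^+ J) `^ (- tau) * (2 ^+ J) ^+ d.
    rewrite -!powR_mulrn ?powR_ge0 ?exprn_ge0 // -!powRrM -powRD.
      by congr (_ `^ _); ring.
    by rewrite pnatr_eq0 implybT.
  by rewrite exprS !exprMn; ring.
move=> n.
have nlt : (n <= nn n)%N.
  rewrite /nn ltnW // ltnS; apply: leq_trans (_ : 2 ^ n <= _)%N; first by rewrite ltnW // ltn_expl.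
  rewrite truncn_ge_nat; last by rewrite mulr_ge0 ?exprn_ge0 ?invr_ge0 // ltW.
  by rewrite natrX ler_peMr ?exprn_ge0 // invf_ge1.
apply: (@le_trans _ _ (\sum_(l < nn n) (1 + rho * l%:R) `^ (- tau) * a l)).
  rewrite -(big_mkord xpredT (fun l => (1 + rho * l%:R) `^ (- tau) * a l)).
  rewrite -[leRHS](big_mkord xpredT (fun l => (1 + rho * l%:R) `^ (- tau) * a l)).
  rewrite [leRHS](@big_cat_nat _ _ _ n) //= lerDl sumr_ge0 // => l _.
  by rewrite mulr_ge0 // powR_ge0.
apply: le_trans (blk n) _.
rewrite -mulrA [_ * (1 + _)]mulrC mulrA mulrDl.
rewrite ler_wpDr ?mul1r ?exprn_ge0 ?invr_ge0 ?(ltW r0)//.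
rewrite ler_wpM2r ?exprn_ge0 ?invr_ge0 ?(ltW r0)//.
by rewrite ler_wpM2l ?mulr_ge0 ?exprn_ge0 // lerD2l ler_wpM2l ?exprn_ge0.
Qed.

(** After exchanging the sums, [e l] is multiplied by the increments with uphalf i <= l, that is i
    <= 2 l. They telescope to at most [w l.*2], and doubling costs the factor A. *)
Lemma sum_increment_uphalf_le (R : realFieldType) (w e : nat -> R) (A : R) (n M : nat) :
  (forall i, 0 <= increment w i) -> (forall l, w l.*2 <= A * w l) ->
  (forall l, 0 <= e l) ->
  \sum_(i < n) increment w i * \sum_(uphalf i <= l < M) e l <=
  A * \sum_(l < M) w l * e l.
Proof.
move=> w0 wA e0.
have wmono p q : (p <= q)%N -> \sum_(i < p) increment w i <= \sum_(i < q) increment w i.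
  move=> pq; rewrite -[leRHS](big_mkord xpredT) (big_cat_nat (n := p)) //= big_mkord.
  by rewrite lerDl sumr_ge0.
under eq_bigr do rewrite big_geq_mkord mulr_sumr.
rewrite (exchange_big_dep xpredT) //= mulr_sumr; apply: ler_sum => l _.
rewrite -mulr_suml mulrA ler_wpM2r //; apply: le_trans (wA l).
rewrite -sum_increment.
apply: (@le_trans _ _ (\sum_(i < n | (i < l.*2.+1)%N) increment w i)).
  by rewrite le_eqVlt; apply/orP; left; apply/eqP; apply: eq_bigl => i;
     rewrite ltnS leq_uphalf_double.
have [nl|ln] := leqP n l.*2.+1.
  apply: le_trans (wmono _ _ nl); rewrite le_eqVlt; apply/orP; left; apply/eqP.
  by apply: eq_bigl => i; rewrite (leq_trans (ltn_ord i) nl).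
by rewrite (big_ord_narrow (ltnW ln)) /=.
Qed.

(** * Concentration of quadratic forms *)

Lemma integrable_bounded d (T : measurableType d) (R : realType)
    (P : probability T R) (D : set T) (f : T -> R) (b : R) :
  measurable D -> measurable_fun D f -> (forall x, D x -> `|f x| <= b) ->
  P.-integrable D (EFin \o f).
Proof.
move=> mD mf fb; apply: measurable_bounded_integrable => //.
  exact: le_lt_trans (probability_le1 P mD) (ltry 1).
exists b; split; first exact: num_real.
by move=> c bc x Dx /=; exact: le_trans (fb _ Dx) (ltW bc).
Qed.

(** Independence makes the law of (U, X) a product measure, and Fubini integrates X first. U takes
    values in an arbitrary measurable space, so that it can carry a whole sigma-algebra of past
    events. *)
Lemma integral_mul_independent d d' (T : measurableType d)
    (T' : measurableType d') (R : realType) (P : probability T R)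
    (U : T -> T') (X : T -> R) (h : T' -> R) (bh bX : R) :
  measurable_fun setT U -> measurable_fun setT X -> measurable_fun setT h ->
  (forall w, `|h w| <= bh) -> (forall w, `|X w| <= bX) ->
  (forall A B, measurable A -> measurable B ->
    P (U @^-1` A `&` X @^-1` B) = (P (U @^-1` A) * P (X @^-1` B))%E) ->
  (\int[P]_w (X w)%:E = 0)%E -> (\int[P]_w (h (U w) * X w)%:E = 0)%E.
Proof.
move=> mU mX mh hb Xb indep X0.
pose UX w := (U w, X w).
have mUX : measurable_fun setT UX by exact: measurable_fun_pair.
pose U' : {mfun T >-> T'} := HB.pack U (isMeasurableFun.Build _ _ _ _ U mU).
pose X' : {mfun T >-> R} := HB.pack X (isMeasurableFun.Build _ _ _ _ X mX).
pose UX' : {mfun T >-> (T' * R)%type} :=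
  HB.pack UX (isMeasurableFun.Build _ _ _ _ UX mUX).
(* X is bounded on T, but the second coordinate of the product space is not; clipping bounds the
   integrand there and leaves X itself unchanged. *)
pose clip (t : R) := Num.max (- bX) (Num.min t bX).
have clipX w : clip (X w) = X w.
  have /ler_normlP[h1 h2] := Xb w.
  by rewrite /clip min_l // max_r //; lra.
have bX0 : 0 <= bX by exact: le_trans (Xb point).
have clipb t : `|clip t| <= bX.
  rewrite ler_norml /clip le_max lexx /= ge_max; apply/andP; split; first by lra.
  by rewrite ge_min lexx orbT.
have mclip : measurable_fun setT clip.
  by apply: measurable_maxr => //; exact: measurable_minr.
pose g (z : T' * R) := h z.1 * clip z.2.
have mg : measurable_fun setT g.
  by apply: measurable_funM; [exact: measurableT_comp mh measurable_fst|
                              exact: measurableT_comp mclip measurable_snd].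
have gb z : `|g z| <= bh * bX by rewrite normrM ler_pM.
have mEg : measurable_fun setT (EFin \o g) by exact/measurable_EFinP.
transitivity (\int[P]_w ((EFin \o g) \o UX') w)%E.
  by apply: eq_integral => w _; rewrite /g /= clipX.
rewrite -integral_distribution //; last first.
  apply: (@integrable_bounded _ _ _ _ _ (g \o UX) (bh * bX)) => //.
    exact: measurableT_comp mg mUX.
  by move=> w _; exact: gb.
transitivity (\int[(distribution P U' \x distribution P X')%E]_z (EFin \o g) z)%E.
  apply: eq_measure_integral => A mA _; apply/esym.
  exact: product_measure_unique.
rewrite -integral12_prod_meas1; last first.
  apply/integrableP; split => //.
  apply: (@le_lt_trans _ _ (\int[(distribution P U' \x distribution P X')%E]_z (bh * bX)%:E)%E).
    apply: ge0_le_integral => //; first exact: measurableT_comp.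
    by move=> z _; rewrite lee_fin.
  rewrite integral_cst //.
  rewrite [X in (_ * X)%E](_ : _ = 1%E) ?mule1 ?ltry //.
  rewrite -setXTT; apply: etrans (product_measure1E _ _ _ _) _ => //.
  by rewrite -[RHS](mule1 1%E); congr (_ * _)%E; exact: probability_setT.
rewrite /fubini_F /=.
apply: integral0_eq => u _.
under eq_integral do rewrite /g /= EFinM.
rewrite integralZl //; last first.
  exact: (@integrable_bounded _ _ _ _ _ clip bX).
rewrite (@integral_distribution _ _ _ _ _ P X' (EFin \o clip)) //; last 2 first.
- exact/measurable_EFinP.
- apply: (@integrable_bounded _ _ _ _ _ (clip \o X) bX) => //.
    exact: measurableT_comp.
  by move=> w _; exact: clipb.
rewrite (_ : (\int[P]_w _)%E = 0%E) ?mule0 //.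
by rewrite -[RHS]X0; apply: eq_integral => w _ /=; rewrite clipX.
Qed.

(** A class closed under sums, products and exponentials, which makes every integrand of the
    supermartingale argument integrable. *)
Definition bounded_measurable d (T : measurableType d) (R : realType)
    (f : T -> R) : Prop :=
  measurable_fun setT f /\ exists b, forall w, `|f w| <= b.

Section BoundedMeasurable.
Context d (T : measurableType d) (R : realType).
Implicit Types f g : T -> R.

Lemma bounded_measurable_cst c : bounded_measurable (fun _ : T => c : R).
Proof. by split => //; exists `|c|. Qed.

Lemma bounded_measurableD f g : bounded_measurable f -> bounded_measurable g ->
  bounded_measurable (fun w => f w + g w).
Proof.
move=> [mf [b fb]] [mg [c gc]]; split; first exact: measurable_funD.
by exists (b + c) => w; rewrite (le_trans (ler_normD _ _)) // lerD.
Qed.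

Lemma bounded_measurableM f g : bounded_measurable f -> bounded_measurable g ->
  bounded_measurable (fun w => f w * g w).
Proof.
move=> [mf [b fb]] [mg [c gc]]; split; first exact: measurable_funM.
by exists (b * c) => w; rewrite normrM ler_pM.
Qed.

Lemma bounded_measurable_expR f : bounded_measurable f ->
  bounded_measurable (fun w => expR (f w)).
Proof.
move=> [mf [b fb]]; split; first exact: measurableT_comp.
exists (expR b) => w; rewrite ger0_norm ?expR_ge0 // ler_expR.
exact: le_trans (ler_norm _) (fb w).
Qed.

Lemma bounded_measurable_sum (I : Type) (r : seq I) (F : I -> T -> R) :
  (forall i, bounded_measurable (F i)) ->
  bounded_measurable (fun w => \sum_(i <- r) F i w).
Proof.
move=> bF; elim: r => [|i r IH].
  by under eq_fun do rewrite big_nil; exact: bounded_measurable_cst.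
by under eq_fun do rewrite big_cons; exact: bounded_measurableD.
Qed.

Lemma bounded_measurable_integrable (P : probability T R) f :
  bounded_measurable f -> P.-integrable setT (EFin \o f).
Proof. by move=> [mf [b fb]]; apply: (@integrable_bounded _ _ _ _ _ _ b). Qed.

End BoundedMeasurable.

(** The cylinder events on the indices before j form a pi-system. On it P(. [&] C) and P(C) P(.)
    agree, C being an event of the j-th variable, so they agree on the generated sigma-algebra. *)
Lemma independent_past d (T : measurableType d) (R : realType)
    (P : probability T R) (n : nat) (X : 'I_n -> T -> R) (j : 'I_n)
    (past := [set A : set T | exists2 B : 'I_n -> set R,
       forall i, measurable (B i) &
       A = \bigcap_(i in [set i : 'I_n | (i < j)%N]) (X i @^-1` B i)]) :
  (forall i, measurable_fun setT (X i)) ->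
  (forall (J : {set 'I_n}) (B : 'I_n -> set R), (forall i, measurable (B i)) ->
    P (\bigcap_(i in [set` J]) (X i @^-1` B i)) =
    (\prod_(i in J) P (X i @^-1` B i))%E) ->
  past `<=` measurable /\
  forall A B, <<s past >> A -> measurable B ->
    P (A `&` X j @^-1` B) = (P A * P (X j @^-1` B))%E.
Proof.
move=> mX indep.
have mpre i B : measurable B -> measurable (X i @^-1` B).
  by move=> mB; rewrite -[_ @^-1` _]setTI; exact: mX.
have past_meas : past `<=` measurable.
  move=> A [B mB ->]; apply: fin_bigcap_measurable => [|i _]; last exact: mpre.
  exact: finite_finset.
split => // A B sA mB.
pose C := X j @^-1` B.
have mC : measurable C by exact: mpre.
have PC0 : 0 <= fine (P C) by exact: fine_ge0.
pose m1 := mrestr P mC.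
pose m2 := mscale (NngNum PC0) P.
have PCE : ((fine (P C))%:E = P C)%E by rewrite fineK // fin_num_measure.
rewrite muleC -PCE.
apply: (@g_sigma_algebra_measure_unique _ _ _ past _ (fun=> setT) _ _ m1 m2) => //.
- move=> _; exists (fun=> setT) => //.
  by apply/seteqP; split => // x _ i.
- by rewrite bigcup_const //; exists 0%N.
- move=> U V [BU mBU ->] [BV mBV ->].
  exists (fun i => BU i `&` BV i); first by move=> i; exact: measurableI.
  apply/seteqP; split => x /=.
    by move=> [h1 h2] i ij; split; [exact: h1|exact: h2].
  by move=> h; split=> i ij; have [] := h i ij.
- move=> U [BU mBU ->].
  rewrite -[LHS]/(P (_ `&` C)) -[RHS]/((fine (P C))%:E * P _)%E PCE muleC.
  pose J := [set i : 'I_n | (i < j)%N]%SET.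
  have -> : [set i : 'I_n | (i < j)%N] = [set` J].
    by apply/seteqP; split => i; rewrite /= inE.
  rewrite indep //.
  pose BJ i := if i == j then B else BU i.
  have := indep (j |: J)%SET BJ.
  rewrite big_setU1 /= ?inE ?ltnn // /BJ eqxx.
  under [in X in _ = X]eq_bigr => i.
    rewrite inE => ij; rewrite (_ : (i == j) = false); last first.
      by apply/eqP => ij'; rewrite ij' ltnn in ij.
    over.
  move=> h; rewrite [RHS]muleC; apply: etrans (h _); last by move=> i; case: ifP.
  congr (P _); apply/seteqP; split => x /=.
    move=> [h1 h2] i /=; rewrite !inE => /orP[/eqP ->|ij]; first by rewrite eqxx.
    case: ifPn => [/eqP ->|_]; first exact: h2.
    by apply: h1; rewrite /= inE.
  move=> h1; split; last by have := h1 j; rewrite /= !inE eqxx => /(_ isT).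
  move=> i; rewrite /= inE => ij; have := h1 i; rewrite /= !inE ij orbT => /(_ isT).
  by case: ifPn => // /eqP ij'; rewrite ij' ltnn in ij.
- move=> _; apply: (@le_lt_trans _ _ 1%E); last exact: ltry.
  by apply: probability_le1; exact: measurableI.
Qed.

Lemma discriminant_le (R : realFieldType) (q r g : R) :
  0 <= g -> (forall s, 0 <= q + 2 * s * r + s ^+ 2 * g) -> r ^+ 2 <= q * g.
Proof.
move=> g0 h; have [g_eq0|gn0] := eqVneq g 0.
  have [->|rn0] := eqVneq r 0; first by rewrite g_eq0 expr0n mulr0.
  (* With g = 0 the expression is affine in s, and this s gives it the value -1. *)
  have := h (- (q + 1) / (2 * r)); rewrite g_eq0 mulr0 addr0.
  have -> : 2 * (- (q + 1) / (2 * r)) * r = - (q + 1) by field.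
  by lra.
have gp : 0 < g by rewrite lt_neqAle eq_sym gn0.
have := h (- r / g).
have -> : q + 2 * (- r / g) * r + (- r / g) ^+ 2 * g = (q * g - r ^+ 2) / g by field.
by rewrite pmulr_lge0 ?invr_gt0 // subr_ge0.
Qed.

Section QuadraticForm.
Context (R : realFieldType) (n : nat) (G : 'I_n -> 'I_n -> R).

Definition qform (v : 'I_n -> R) : R := \sum_a \sum_b v a * v b * G a b.

Definition qpolar (v : 'I_n -> R) (j : 'I_n) : R := \sum_a v a * G a j.

Lemma qform_add1 (v : 'I_n -> R) (j : 'I_n) (e : R) :
  (forall a b, G a b = G b a) ->
  qform (fun a => v a + (if a == j then e else 0)) =
  qform v + 2 * e * qpolar v j + e ^+ 2 * G j j.
Proof.
move=> Gsym.
have del (F : 'I_n -> R) : \sum_a (if a == j then e else 0) * F a = e * F j.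
  rewrite (bigD1 j) //= eqxx big1 ?addr0 // => a /negPf ->; exact: mul0r.
have E1 : \sum_a \sum_b v a * (if b == j then e else 0) * G a b = e * qpolar v j.
  rewrite /qpolar mulr_sumr; apply: eq_bigr => a _.
  rewrite -(del (fun b => v a * G a b)).
  by apply: eq_bigr => b _; ring.
have E2 : \sum_a \sum_b (if a == j then e else 0) * v b * G a b = e * qpolar v j.
  rewrite -E1 exchange_big /=; apply: eq_bigr => b _; apply: eq_bigr => a _.
  by rewrite (Gsym a b); ring.
have E3 : \sum_a \sum_b (if a == j then e else 0) * (if b == j then e else 0) * G a b
    = e ^+ 2 * G j j.
  rewrite expr2 -mulrA -(del (fun a => e * G a j)); apply: eq_bigr => a _.
  rewrite -(del (fun b => G a b)) mulr_sumr.
  by apply: eq_bigr => b _; ring.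
rewrite /qform.
transitivity (\sum_a \sum_b (v a * v b * G a b) +
  \sum_a \sum_b v a * (if b == j then e else 0) * G a b +
  \sum_a \sum_b (if a == j then e else 0) * v b * G a b +
  \sum_a \sum_b (if a == j then e else 0) * (if b == j then e else 0) * G a b).
  rewrite -!big_split /=; apply: eq_bigr => a _.
  rewrite -!big_split /=; apply: eq_bigr => b _.
  move: (if a == j then e else 0) (if b == j then e else 0) => ea eb.
  by ring.
by rewrite E1 E2 E3; ring.
Qed.

Lemma qpolar_sqr_le (v : 'I_n -> R) (j : 'I_n) :
  (forall a b, G a b = G b a) -> (forall u, 0 <= qform u) -> 0 <= G j j ->
  qpolar v j ^+ 2 <= qform v * G j j.
Proof.
move=> Gsym Gpos g0; apply: discriminant_le => // s.
by rewrite -qform_add1.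
Qed.

End QuadraticForm.

(* With [lam t = lam (2 - t / n)], the sequence [exp (lam t * q t)] is, up to
   factors whose product stays bounded, a supermartingale.  The comparison is
   pointwise, [expR_le_add_expR_sqr] isolating a term linear in the newest
   variable, whose expectation vanishes by independence. *)
Lemma qform_tail d (T : measurableType d) (R : realType)
    (P : probability T R) (n : nat) (X : 'I_n -> T -> R) (G : 'I_n -> 'I_n -> R)
    (M g tau : R) :
  (0 < n)%N -> 0 < M -> 0 < g ->
  (forall a b, G a b = G b a) -> (forall u, 0 <= qform G u) ->
  (forall j, 0 <= G j j <= g) ->
  (forall i, measurable_fun setT (X i)) ->
  (forall i w, `|X i w| <= M) ->
  (forall i, \int[P]_w (X i w)%:E = 0)%E ->
  (forall (J : {set 'I_n}) (B : 'I_n -> set R), (forall i, measurable (B i)) ->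
    P (\bigcap_(i in [set` J]) (X i @^-1` B i)) =
    (\prod_(i in J) P (X i @^-1` B i))%E) ->
  (P [set w | (tau <= qform G (X ^~ w))%R]
    <= (2 * expR (- (tau / (48 * n%:R * M ^+ 2 * g))))%:E)%E.
Proof.
move=> n0 M0 g0 Gsym Gpos Gdiag mX Xb X0 indep.
have nR : 0 < n%:R :> R by rewrite ltr0n.
(* Here 48 = 12 * 2^2: a step with parameter l <= 2 lam costs at most 12 l^2 M^2 g <= 48 lam^2 M^2 g
   = lam / n, exactly the drop of [l] from one step to the next. *)
pose lam := (48 * n%:R * M ^+ 2 * g)^-1.
have K0 : 0 < 48 * n%:R * M ^+ 2 * g by rewrite !mulr_gt0 // exprn_gt0.
have lam0 : 0 < lam by rewrite invr_gt0.
pose l t := lam * (2 - t%:R / n%:R).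
(* Variables not yet revealed are set to 0, so [q t] depends on the first t variables only. *)
pose Xt t (a : 'I_n) : T -> R := if (a < t)%N then X a else fun=> 0.
pose q t w := qform G (Xt t ^~ w).
have bX i : bounded_measurable (X i) by split => //; exists M.
have bXt t i : bounded_measurable (Xt t i).
  rewrite /Xt; case: ifP => _; [exact: bX|exact: bounded_measurable_cst].
have bq t : bounded_measurable (q t).
  do 2 (apply: bounded_measurable_sum => ?).
  apply: bounded_measurableM; last exact: bounded_measurable_cst.
  exact: bounded_measurableM.
have q0 t w : 0 <= q t w by exact: Gpos.
have bE c t : bounded_measurable (fun w => expR (c * q t w)).
  apply: bounded_measurable_expR; apply: bounded_measurableM => //.
  exact: bounded_measurable_cst.
pose E t := \int[P]_w expR (l t * q t w).
have step t : (t < n)%N -> E t.+1 <= expR (2 * lam * M ^+ 2 * g) * E t.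
  move=> tn; pose j := Ordinal tn.
  pose r w := qpolar G (Xt t ^~ w) j.
  have l1 : l t.+1 <= 2 * lam.
    by rewrite /l mulrC ler_wpM2r ?(ltW lam0) // gerBl divr_ge0.
  have l1p : 0 <= l t.+1.
    rewrite /l mulr_ge0 ?(ltW lam0) // subr_ge0 ler_pdivrMr //.
    by rewrite -natrM ler_nat (leq_trans tn) // leq_pmull.
  have lstep : l t.+1 + 12 * l t.+1 ^+ 2 * M ^+ 2 * g <= l t.
    have -> : l t = l t.+1 + 48 * lam ^+ 2 * M ^+ 2 * g.
      have KE : lam = 48 * lam ^+ 2 * M ^+ 2 * g * n%:R.
        by rewrite /lam; field; rewrite !gt_eqF.
      have -> : 48 * lam ^+ 2 * M ^+ 2 * g = lam / n%:R.
        by apply: (mulIf (x := n%:R)); rewrite ?gt_eqF // -KE divfK ?gt_eqF.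
      by rewrite /l -natr1; field; rewrite gt_eqF.
    rewrite lerD2l ler_wpM2r ?(ltW g0) // ler_wpM2r ?exprn_ge0 ?(ltW M0) //.
    have := ler_pM l1p l1p l1 l1; rewrite -!expr2 => h; nra.
  have qS w : q t.+1 w = q t w + 2 * X j w * r w + X j w ^+ 2 * G j j.
    rewrite /q /r -qform_add1 //; congr qform; apply/funext => a.
    rewrite /Xt ltnS leq_eqVlt -(inj_eq val_inj) /=.
    case: eqVneq => [at_|_] /=; last by rewrite addr0.
    rewrite at_ ltnn add0r; congr (X _ w).
    exact: val_inj.
  (* The coefficient of the newest variable after linearization; it involves earlier variables
     only. *)
  pose h w := expR (l t.+1 * q t w + l t.+1 * M ^+ 2 * g) * (2 * l t.+1 * r w).
  have pw w : expR (l t.+1 * q t.+1 w) <=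
      h w * X j w + expR (2 * lam * M ^+ 2 * g) * expR (l t * q t w).
    have X2 : X j w ^+ 2 <= M ^+ 2.
      by rewrite -real_normK ?num_real // lerXn2r ?nnegrE ?(ltW M0).
    have /andP[G0 Gg] := Gdiag j.
    have r2 : r w ^+ 2 <= q t w * g.
      apply: le_trans (qpolar_sqr_le _ Gsym Gpos G0) _.
      by rewrite ler_wpM2l.
    have X2G : X j w ^+ 2 * G j j <= M ^+ 2 * g by rewrite ler_pM // sqr_ge0.
    have XR : X j w ^+ 2 * r w ^+ 2 <= M ^+ 2 * (q t w * g) by rewrite ler_pM // sqr_ge0.
    set c1 := l t.+1 * q t w + l t.+1 * M ^+ 2 * g.
    apply: (@le_trans _ _ (expR c1 * expR (2 * l t.+1 * r w * X j w))).
      rewrite -expRD ler_expR qS /c1 !mulrDr.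
      have := ler_wpM2l l1p X2G; lra.
    (* The exponent 3 (2 l r X)^2 = 12 l^2 r^2 X^2 is at most 12 l^2 M^2 g q, because r^2 <= q g. *)
    apply: (@le_trans _ _ (expR c1 * (2 * l t.+1 * r w * X j w +
        expR (12 * l t.+1 ^+ 2 * M ^+ 2 * g * q t w)))).
      rewrite ler_wpM2l ?expR_ge0 //; apply: le_trans (expR_le_add_expR_sqr _) _.
      rewrite lerD2l ler_expR.
      have := ler_wpM2l (sqr_ge0 (l t.+1)) XR; nra.
    rewrite mulrDr /h -/c1 [X in X + _]mulrA lerD2l -!expRD ler_expR /c1.
    have := ler_wpM2r (q0 t w) lstep.
    have := ler_wpM2r (ltW g0) (ler_wpM2r (ltW (exprn_gt0 2 M0)) l1).
    lra.
  have br : bounded_measurable r.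
    apply: bounded_measurable_sum => a.
    by apply: bounded_measurableM => //; exact: bounded_measurable_cst.
  have bh : bounded_measurable h.
    apply: bounded_measurableM; last first.
      by apply: bounded_measurableM => //; exact: bounded_measurable_cst.
    apply: bounded_measurable_expR; apply: bounded_measurableD.
      by apply: bounded_measurableM => //; exact: bounded_measurable_cst.
    exact: bounded_measurable_cst.
  have bhX : bounded_measurable (fun w => h w * X j w) by exact: bounded_measurableM.
  have hX0 : \int[P]_w (h w * X j w) = 0.
    have [past_meas past_indep] := independent_past j mX indep.
    set past := (X in X `<=` _) in past_meas.
    (* T' is T with the sigma-algebra of the past. There [h] is measurable, and the identity from T
       to T' is the map U of [integral_mul_independent]. *)
    pose T' := g_sigma_algebraType past.
    have bXt' i : bounded_measurable (Xt t i : T' -> R).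
      rewrite /Xt; case: ifP => it; last exact: bounded_measurable_cst.
      split; last by exists M.
      move=> _ B mB; rewrite setTI; apply: sub_sigma_algebra.
      exists (fun k => if k == i then B else setT); first by move=> k; case: ifP.
      apply/seteqP; split => w /=.
        by move=> wB k /= _; case: eqP => // ->.
      by move=> /(_ i it); rewrite eqxx.
    have bq' : bounded_measurable (q t : T' -> R).
      do 2 (apply: bounded_measurable_sum => ?).
      apply: bounded_measurableM; last exact: bounded_measurable_cst.
      exact: bounded_measurableM.
    have br' : bounded_measurable (r : T' -> R).
      apply: bounded_measurable_sum => a.
      by apply: bounded_measurableM => //; exact: bounded_measurable_cst.
    have [mh [bh0 hb]] : bounded_measurable (h : T' -> R).
      apply: bounded_measurableM; last first.
        by apply: bounded_measurableM => //; exact: bounded_measurable_cst.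
      apply: bounded_measurable_expR; apply: bounded_measurableD.
        by apply: bounded_measurableM => //; exact: bounded_measurable_cst.
      exact: bounded_measurable_cst.
    rewrite /Rintegral.
    rewrite (@integral_mul_independent _ _ T T' _ P id (X j) h bh0 M) //.
    move=> _ A mA; rewrite setTI preimage_id.
    by move: A mA; apply: smallest_sub => //; exact: sigma_algebra_measurable.
  apply: (@le_trans _ _ (\int[P]_w (h w * X j w +
      expR (2 * lam * M ^+ 2 * g) * expR (l t * q t w)))).
    apply: le_Rintegral => //; first exact: bounded_measurable_integrable.
    apply: bounded_measurable_integrable.
    apply: bounded_measurableD => //; apply: bounded_measurableM => //.
    exact: bounded_measurable_cst.
  rewrite RintegralD //; last 2 first.
  - exact: bounded_measurable_integrable.
  - apply: bounded_measurable_integrable; apply: bounded_measurableM => //.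
    exact: bounded_measurable_cst.
  by rewrite hX0 add0r RintegralZl //; exact: bounded_measurable_integrable.
have E0 : E 0%N = 1.
  transitivity (\int[P]_w (1 : R)).
    apply: eq_Rintegral => w _; rewrite /q /qform big1 ?mulr0 ?expR0 // => a _.
    by rewrite big1 // => b _; rewrite /Xt ltn0 !mul0r.
  by rewrite Rintegral_cst // mul1r (_ : _ setT = 1%E) //; exact: probability_setT.
have Et t : (t <= n)%N -> E t <= expR (2 * lam * M ^+ 2 * g) ^+ t.
  elim: t => [_|t IH tn]; first by rewrite E0.
  apply: le_trans (step _ tn) _.
  by rewrite [leRHS]exprS ler_wpM2l ?expR_ge0 // IH // ltnW.
(* The n steps together cost exp (2 lam M^2 g n) = exp (1/24); hence the factor 2 in the
   conclusion. *)
have En : E n <= 2.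
  apply: le_trans (Et n (leqnn _)) _.
  rewrite -expRM_natr.
  have -> : 2 * lam * M ^+ 2 * g * n%:R = 24^-1 :> R.
    by rewrite /lam; field; rewrite !gt_eqF.
  have h1 := expR_ge1Dx (- (24^-1) : R).
  rewrite -[24^-1]opprK expRN invf_ple ?posrE ?expR_gt0 //; lra.
have qn w : qform G (X ^~ w) = q n w.
  by rewrite /q; congr qform; apply/funext => a; rewrite /Xt ltn_ord.
have ln : l n = lam by rewrite /l divff ?gt_eqF //; ring.
set A := [set w | _].
have mA : measurable A.
  rewrite (_ : A = q n @^-1` `[tau, +oo[).
    by rewrite -[_ @^-1` _]setTI; apply: (proj1 (bq n)).
  by rewrite /A; apply/seteqP; split => w /=; rewrite in_itv /= andbT -qn.
have -> : P A = (\int[P]_w (\1_A w : R)%:E)%E by rewrite integral_indic // setIT.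
have b1 : bounded_measurable (\1_A : T -> R).
  split; first exact: measurable_indic.
  by exists 1 => w; rewrite indicE; case: (_ \in _); rewrite ?normr1 ?normr0.
rewrite -[(\int[P]_w _)%E]fineK; last first.
  exact: integrable_fin_num (bounded_measurable_integrable P b1).
rewrite lee_fin -/(Rintegral P setT (\1_A : T -> R)).
(* Markov's inequality: on the event the exponent lam (q - tau) is nonnegative. *)
apply: (@le_trans _ _ (\int[P]_w (expR (- (lam * tau)) * expR (l n * q n w)))).
  apply: le_Rintegral => //.
  - exact: bounded_measurable_integrable.
  - apply: bounded_measurable_integrable; apply: bounded_measurableM => //.
    exact: bounded_measurable_cst.
  move=> w _; rewrite -expRD.
  have [wA|] := boolP (w \in A); last by rewrite expR_ge0.
  rewrite -expR0 ler_expR ln addrC subr_ge0 ler_wpM2l ?(ltW lam0) //.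
  by move: wA; rewrite inE /A /= qn.
rewrite RintegralZl //; last exact: bounded_measurable_integrable.
rewrite mulrC ler_pM ?expR_ge0 //; first by apply: Rintegral_ge0 => w _; exact: expR_ge0.
by rewrite ler_expR lerN2 mulrC.
Qed.

Lemma measurable_qform d (T : measurableType d) (R : realType) n
    (G : 'I_n -> 'I_n -> R) (X : 'I_n -> T -> R) :
  (forall i, measurable_fun setT (X i)) ->
  measurable_fun setT (fun w => qform G (X ^~ w)).
Proof.
move=> mX; apply: measurable_sum => a; apply: measurable_sum => b.
by apply: measurable_funM => //; exact: measurable_funM.
Qed.

(* Replacing the noise by [0] where it exceeds the bound reduces this to
   [qform_tail]. *)
Lemma qform_tail_ae d (T : measurableType d) (R : realType)
    (P : probability T R) n (X : 'I_n -> {RV P >-> R})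
    (G : 'I_n -> 'I_n -> R) (M g tau : R) :
  (0 < n)%N -> 0 < M -> 0 < g ->
  (forall a b, G a b = G b a) -> (forall u, 0 <= qform G u) ->
  (forall j, 0 <= G j j <= g) ->
  mutually_independent X ->
  (forall i, ('E_P[X i] = 0)%E) ->
  (forall i, {ae P, forall w, `|X i w| <= M}) ->
  (P [set w | (tau <= qform G (fun i => X i w))%R] <=
   (2 * expR (- (tau / (48 * n%:R * M ^+ 2 * g))))%:E)%E.
Proof.
move=> n0 M0 g0 Gs Gp Gg indX meanX bX.
pose cut (t : R) : R := if `|t| <= M then t else 0.
have mcut : measurable_fun setT cut.
  apply: measurable_fun_ifT => //.
  by apply: measurable_fun_ler => //; exact: measurableT_comp.
pose X' i w := cut (X i w).
have mX i : measurable_fun setT (X i : T -> R) by exact: measurable_funP.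
have mX' i : measurable_fun setT (X' i) by exact: measurableT_comp.
have eX i : {ae P, forall w, X' i w = X i w}.
  apply: filterS (bX i) => w hw; by rewrite /X' /cut hw.
have mean0 i : (\int[P]_w (X' i w)%:E = 0)%E.
  rewrite -(meanX i) expectation_def; apply: ae_eq_integral => //.
  - exact/measurable_EFinP.
  - exact/measurable_EFinP.
  - by apply: filterS (eX i) => w hw _; rewrite /= hw.
have X'M i w : `|X' i w| <= M.
  by rewrite /X' /cut; case: ifP => // _; rewrite normr0 ltW.
have ind' (J : {set 'I_n}) (B : 'I_n -> set R) : (forall i, measurable (B i)) ->
    (P (\bigcap_(i in [set` J]) (X' i @^-1` B i)) =
     \prod_(i in J) P (X' i @^-1` B i))%E.
  move=> mB; apply: (indX J (fun i => cut @^-1` B i)) => i.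
  by rewrite -[X in measurable X]setTI; exact: mcut.
have tail := @qform_tail _ _ _ P n X' G M g tau n0 M0 g0 Gs Gp Gg mX' X'M mean0 ind'.
apply: le_trans tail.
have [N [mN N0 sN]] : {ae P, forall w, forall i, X' i w = X i w}.
  exact: filter_forall.
have mA (X1 : 'I_n -> T -> R) : (forall i, measurable_fun setT (X1 i)) ->
    measurable [set w | (tau <= qform G (X1 ^~ w))%R].
  by move=> m1; rewrite -[X in measurable X]setTI; apply: measurable_fun_le => //; exact: measurable_qform.
rewrite -[leRHS](measureU0 _ mN N0); last exact: mA.
apply: le_measure; rewrite ?inE; [exact: mA|by apply: measurableU => //; exact: mA|].
move=> w /= h; have [nw|nw] := pselect (N w); [by right|left].
have e : forall i, X' i w = X i w by apply: contrapT => h'; exact/nw/sN.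
by rewrite (_ : X' ^~ w = fun i => X i w) //; apply/funext.
Qed.

(** * Decomposition of polynomials into harmonics *)

Section HarmonicDecomposition.
Context (R : realType) (n : nat).
Local Notation MP := (mpoly.mpoly n.+1 R).
Local Notation homog e := (mpoly.ishomog1 (n := n.+1) (R := R) e (mpoly.mdeg (n := n.+1))).
Local Notation XU i := (mpoly.mpolyX R (mpoly.mnm1 (n := n.+1) i)).
Implicit Types (p q h : MP) (e t j : nat).

Definition laplacian p : MP :=
  \sum_(i < n.+1) mpoly.mderiv i (mpoly.mderiv i p).

Definition sqradius : MP := \sum_(i < n.+1) XU i ^+ 2.

Lemma laplacianD : {morph laplacian : p q / p + q}.
Proof.
move=> p q; rewrite /laplacian -big_split /=.
by apply: eq_bigr => i _; rewrite !mpoly.mderivD.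
Qed.

Lemma laplacianZ (c : R) p : laplacian (c *: p) = c *: laplacian p.
Proof.
rewrite /laplacian scaler_sumr.
by apply: eq_bigr => i _; rewrite !mpoly.mderivZ.
Qed.

Lemma iter_laplacianZ t (c : R) p :
  iter t laplacian (c *: p) = c *: iter t laplacian p.
Proof. by elim: t => //= t ->; rewrite laplacianZ. Qed.

Lemma iter_laplacianD t : {morph iter t laplacian : p q / p + q}.
Proof. by move=> p q; elim: t => //= t ->; rewrite laplacianD. Qed.

Lemma mderiv_homog i e p : p \is homog e -> mpoly.mderiv i p \is homog e.-1.
Proof.
move=> /mpoly.dhomogP hp; apply/mpoly.dhomogP => m.
rewrite mpoly.mcoeff_msupp mpoly.mcoeff_deriv => c0.
have /hp <- : mpoly.mnm_add m (mpoly.mnm1 i) \in mpoly.msupp p.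
  by rewrite mpoly.mcoeff_msupp; apply: contraNneq c0 => ->; rewrite mul0rn.
by rewrite /= mpoly.mdegD mpoly.mdeg1 addn1.
Qed.

Lemma mderiv_homog0 i p : p \is homog 0%N -> mpoly.mderiv i p = 0.
Proof.
move=> /mpoly.dhomogP hp; apply/mpoly.mpolyP => m.
rewrite mpoly.mcoeff_deriv mpoly.mcoeff0.
have [/hp /=|c0] := boolP (mpoly.mnm_add m (mpoly.mnm1 i) \in mpoly.msupp p).
  by rewrite mpoly.mdegD mpoly.mdeg1 addn1.
by rewrite mpoly.memN_msupp_eq0 // mul0rn.
Qed.

Lemma laplacian_homog e p : p \is homog e -> laplacian p \is homog (e - 2)%N.
Proof.
move=> hp; have -> : (e - 2 = e.-1.-1)%N by rewrite -!subn1 -subnDA.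
by apply: rpred_sum => i _; do 2 apply: mderiv_homog.
Qed.

Lemma laplacian_homog_lt2 e p : (e < 2)%N -> p \is homog e -> laplacian p = 0.
Proof.
move=> e2 hp; rewrite /laplacian big1 // => i _; apply: mderiv_homog0.
by have := mderiv_homog i hp; case: e e2 {hp} => [|[|]].
Qed.

Lemma iter_laplacian_homog t e p : p \is homog e ->
  iter t laplacian p \is homog (e - t.*2)%N.
Proof.
elim: t e p => [|t IH] e p hp; first by rewrite subn0.
by rewrite iterSr doubleS -addn2 addnC subnDA IH // laplacian_homog.
Qed.

Lemma iter_laplacian_eq0 t e p : (e < t.*2)%N -> p \is homog e ->
  iter t laplacian p = 0.
Proof.
have lap0 : laplacian 0 = 0 by rewrite -(scale0r 0) laplacianZ !scale0r.
elim: t e p => [//|t IH] e p; rewrite doubleS iterSr => et hp.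
have [e2|e2] := ltnP e 2.
  by rewrite (laplacian_homog_lt2 e2 hp); elim: t {IH et} => //= t ->.
apply: IH (laplacian_homog hp).
by rewrite ltn_subLR.
Qed.

Lemma Euler_homog e p : p \is homog e ->
  \sum_(i < n.+1) XU i * mpoly.mderiv i p = e%:R *: p.
Proof.
move=> /mpoly.dhomogP hp.
rewrite {1 2}(mpoly.mpolyE p) scaler_sumr.
under eq_bigr do rewrite raddf_sum mulr_sumr.
rewrite exchange_big /=; apply: eq_big_seq => m /hp /= <-.
rewrite mpoly.mdegE natr_sum scaler_suml; apply: eq_bigr => i _.
rewrite mpoly.mderivZ mpoly.mderivX -!scalerAr !scalerA mulrC.
have [->|mi0] := eqVneq (m i) 0%N; first by rewrite !mul0r !scale0r.
congr (_ *: _); rewrite -mpoly.mpolyXD; congr (mpoly.mpolyX _ _).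
by rewrite mpoly.addmC mpoly.submK // mpoly.lep1mP.
Qed.

Lemma mderiv_XU i k : mpoly.mderiv i (XU k) = (i == k)%:R.
Proof.
rewrite mpoly.mderivX mpoly.mnm1E eq_sym; case: eqP => [->|_]; last by rewrite scale0r.
rewrite scale1r -mpoly.mpolyX0; congr (mpoly.mpolyX _ _).
by apply/mpoly.mnmP => l; rewrite mpoly.mnmBE subnn mpoly.mnm0E.
Qed.

Lemma mderiv_sqradius i : mpoly.mderiv i sqradius = XU i *+ 2.
Proof.
rewrite /sqradius raddf_sum (bigD1 i) //= big1 => [|k ki].
  by rewrite addr0 expr2 mpoly.mderivM mderiv_XU eqxx mul1r mulr1 mulr2n.
by rewrite expr2 mpoly.mderivM mderiv_XU eq_sym (negPf ki) mul0r mulr0 addr0.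
Qed.

Lemma sqradius_homog : sqradius \is homog 2%N.
Proof.
apply: rpred_sum => i _; rewrite -[2%N]mul1n; apply: mpoly.dhomogMn.
by rewrite mpoly.dhomogX /= mpoly.mdeg1.
Qed.

(** By the Leibniz rule the second derivatives of the squared radius contribute 2 (n + 1), and the
    cross terms 4 sum_i x_i d_i p equal 4 e p by Euler's identity. *)
Lemma laplacian_sqradiusM e p : p \is homog e ->
  laplacian (sqradius * p) =
  (n.+1%:R * 2 + e%:R * 4) *: p + sqradius * laplacian p.
Proof.
move=> hp; rewrite /laplacian.
have E i : mpoly.mderiv i (mpoly.mderiv i (sqradius * p)) =
    p *+ 2 + (XU i * mpoly.mderiv i p) *+ 4 +
    sqradius * mpoly.mderiv i (mpoly.mderiv i p).
  rewrite mpoly.mderivM mpoly.mderivD !mpoly.mderivM !mderiv_sqradius.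
  by rewrite mpoly.mderivMn mderiv_XU eqxx mulr1n; ring.
under eq_bigr do rewrite E.
rewrite !big_split /= -mulr_sumr; congr (_ + _).
rewrite (Euler_homog hp) sumr_const card_ord -scaler_nat -!scalerDl.
by congr (_ *: _); ring.
Qed.

(** Each further factor [sqradius] adds a nonnegative multiple to a positive constant, so the
    constant stays invertible. *)
Lemma laplacian_sqradiusXM e h j : h \is homog e -> laplacian h = 0 ->
  exists2 c : R, 0 < c &
    laplacian (sqradius ^+ j.+1 * h) = c *: (sqradius ^+ j * h).
Proof.
move=> hh h0; elim: j => [|j [c c0 IH]].
  exists (n.+1%:R * 2 + e%:R * 4).
    by rewrite ltr_pwDl ?mulr_ge0 // mulr_gt0 // ltr0Sn.
  by rewrite expr1 (laplacian_sqradiusM hh) h0 mulr0 addr0 expr0 mul1r.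
exists (n.+1%:R * 2 + (2 * j.+1 + e)%:R * 4 + c).
  by rewrite ltr_wpDl // addr_ge0 // mulr_ge0.
rewrite exprS -mulrA (@laplacian_sqradiusM (2 * j.+1 + e)%N); last first.
  by apply: mpoly.dhomogM => //; apply: mpoly.dhomogMn; exact: sqradius_homog.
rewrite IH -scalerAr mulrA -exprS -scalerDl; congr (_ *: _).
Qed.

Lemma iter_laplacian_sqradiusXM e h t : h \is homog e -> laplacian h = 0 ->
  exists2 c : R, 0 < c & iter t laplacian (sqradius ^+ t * h) = c *: h.
Proof.
move=> hh h0; elim: t => [|t [c c0 IH]].
  by exists 1 => //=; rewrite expr0 mul1r scale1r.
have [b b0 hb] := laplacian_sqradiusXM t hh h0.
exists (b * c); first exact: mulr_gt0.
by rewrite iterSr hb iter_laplacianZ IH scalerA.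
Qed.

End HarmonicDecomposition.

Section PolynomialsOnSphere.
Context (R : realType) (d : nat).
Local Notation V := 'rV[R]_d.+1.
Local Notation homog e := (mpoly.ishomog1 (n := d.+1) (R := R) e (mpoly.mdeg (n := d.+1))).

Lemma enorm_sqr (n : nat) (x : 'rV[R]_n) : enorm x ^+ 2 = \sum_i x ord0 i ^+ 2.
Proof. by rewrite sqr_sqrtr // sumr_ge0 // => i _; exact: sqr_ge0. Qed.

Lemma sphere_sum_sqr (x : V) : sphere R d x -> \sum_i x ord0 i ^+ 2 = 1.
Proof. by rewrite /sphere /= => x1; rewrite -enorm_sqr x1 expr1n. Qed.

Lemma meval_sqradius (x : V) : sphere R d x -> mpoly.meval (x ord0) (sqradius R d) = 1.
Proof.
move=> /sphere_sum_sqr <-; rewrite raddf_sum; apply: eq_bigr => i _.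
by rewrite /= expr2 mpoly.mevalM mpoly.mevalXU -expr2.
Qed.

Lemma meval_sqradiusX (x : V) t : sphere R d x ->
  mpoly.meval (x ord0) (sqradius R d ^+ t) = 1.
Proof.
move=> Sx; elim: t => [|t IH]; first by rewrite expr0 mpoly.meval1.
by rewrite exprS mpoly.mevalM IH meval_sqradius // mulr1.
Qed.

Lemma spherical_harmonicD l (f g : V -> R) : spherical_harmonic l f ->
  spherical_harmonic l g -> spherical_harmonic l (fun x => f x + g x).
Proof.
move=> [p [hp p0 pf]] [q [hq q0 qg]]; exists (p + q); split.
- exact: rpredD.
- by rewrite -/(laplacian _) laplacianD /laplacian p0 q0 addr0.
- by move=> x Sx; rewrite mpoly.mevalD pf // qg.
Qed.

Lemma spherical_harmonic0 l : spherical_harmonic l (fun _ : V => 0 : R).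
Proof.
exists 0; split; first exact: rpred0.
- by rewrite big1 // => i _; rewrite !mpoly.mderiv0.
- by move=> x _; rewrite mpoly.meval0.
Qed.

(** If the (t+1)-st iterated Laplacian kills p, then h, the t-th one, is harmonic, and subtracting a
    multiple of r^(2t) h makes the t-th one vanish too. On the sphere r = 1, so the subtracted term
    is itself a harmonic, of degree e - 2t. *)
Lemma homog_sphere_decomp_iter t e (p : mpoly.mpoly d.+1 R) : p \is homog e ->
  iter t (@laplacian R d) p = 0 ->
  exists2 g : nat -> V -> R, forall l, spherical_harmonic l (g l) &
    forall x, sphere R d x -> mpoly.meval (x ord0) p = \sum_(l < e.+1) g l x.
Proof.
elim: t p => [|t IH] p hp /= pt0.
  rewrite pt0; exists (fun _ _ => 0); first exact: spherical_harmonic0.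
  by move=> x _; rewrite mpoly.meval0 big1.
(* Excludes the case where the subtraction e - 2t truncates; the t-th Laplacian already vanishes
   there. *)
have [te|te] := ltnP e t.*2; first by apply: IH => //; exact: iter_laplacian_eq0 hp.
pose h := iter t (@laplacian R d) p.
have hh : h \is homog (e - t.*2)%N by exact: iter_laplacian_homog.
have [c c0 hc] := iter_laplacian_sqradiusXM t hh pt0.
have hq : p - c^-1 *: (sqradius R d ^+ t * h) \is homog e.
  rewrite rpredB // rpredZ // -[e](subnKC te); apply: mpoly.dhomogM => //.
  by rewrite -mul2n; apply: mpoly.dhomogMn; exact: sqradius_homog.
have [|g gh gE] := IH _ hq.
  rewrite iter_laplacianD -scaleNr iter_laplacianZ hc scalerA mulNr mulVf ?gt_eqF //.
  by rewrite scaleN1r subrr.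
exists (fun l x => g l x + if l == (e - t.*2)%N then c^-1 * mpoly.meval (x ord0) h else 0).
  move=> l; apply: spherical_harmonicD => //.
  case: eqP => [->|_]; last exact: spherical_harmonic0.
  exists (c^-1 *: h); split; first exact: rpredZ.
    by rewrite -/(laplacian _) laplacianZ pt0 scaler0.
  by move=> x Sx; rewrite mpoly.mevalZ.
move=> x Sx; rewrite big_split /= -gE // mpoly.mevalB mpoly.mevalZ mpoly.mevalM.
rewrite meval_sqradiusX // mul1r -big_mkcond /=.
have lt : (e - t.*2 < e.+1)%N by rewrite ltnS leq_subr.
by rewrite (big_pred1 (Ordinal lt)) ?subrK // => i; rewrite -(inj_eq val_inj).
Qed.

Lemma homog_sphere_decomp e (p : mpoly.mpoly d.+1 R) : p \is homog e ->
  exists2 g : nat -> V -> R, forall l, spherical_harmonic l (g l) &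
    forall x, sphere R d x -> mpoly.meval (x ord0) p = \sum_(l < e.+1) g l x.
Proof.
move=> hp; apply: (@homog_sphere_decomp_iter e.+1) => //.
by apply: iter_laplacian_eq0 hp; rewrite doubleS -addnn ltnS -addnS leq_addr.
Qed.

(** The binomial is the dimension of the homogeneous polynomials of degree L in d + 1 variables. *)
Lemma bin_leX (L : nat) : ('C(L + d, d) <= L.+1 ^ d)%N.
Proof.
elim: d => [|e IH]; first by rewrite bin0.
rewrite -(leq_pmul2l (ltn0Sn e)) -mul_bin_diag addnS /=.
rewrite expnS mulnA; apply: leq_mul => //.
by rewrite mulSnr mulnS addnS ltnS addnC -addnA leq_add2l leq_addl.
Qed.

(** Independence of the restrictions to the sphere forces independence of the polynomials. Fixing
    one common degree L gives the exponent d; all degrees up to L would give d + 1. *)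
Lemma card_indep_homog (I : finType) (L : nat) (f : I -> V -> R) :
  (forall i, exists2 p, p \is homog L &
     forall x, sphere R d x -> f i x = mpoly.meval (x ord0) p) ->
  (forall k : I -> R, (forall x, sphere R d x -> \sum_i k i * f i x = 0) ->
     forall i, k i = 0) ->
  (#|I| <= L.+1 ^ d)%N.
Proof.
move=> fp indep.
have fp' i : exists p : mpoly.dhomog d.+1 R L,
    forall x, sphere R d x -> f i x = mpoly.meval (x ord0) (mpoly.mpoly_of_dhomog p).
  by have [p hp pf] := fp i; exists (mpoly.DHomog hp).
have {fp fp'}[p pf] := choice fp'.
pose X := [tuple p (enum_val i) | i < #|I|].
have fX : free X.
  apply/freeP => k k0 i.
  have := indep (fun j => k (enum_rank j)).
  rewrite -[i](enum_valK) => /(_ _ (enum_val i)); apply => x Sx.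
  have := congr1 (fun q => mpoly.meval (x ord0) (mpoly.mpoly_of_dhomog q)) k0.
  rewrite !raddf_sum /= mpoly.meval0 => h0; rewrite -[RHS]h0.
  rewrite (reindex _ (onW_bij _ (@enum_val_bij I))) /=; apply: eq_bigr => j _.
  have -> : [seq p (enum_val i0) | i0 <- enum 'I_#|I|]`_j = p (enum_val j).
    by rewrite (nth_map j) ?size_enum_ord ?nth_ord_enum.
  by rewrite enum_valK pf // -mpoly.mevalZ.
apply: leq_trans (bin_leX L).
rewrite -bin_sub ?leq_addl // addnK.
have := dimvS (subvf <<X>>%VS); rewrite dimvf.
by have /eqP -> := fX; rewrite size_tuple.
Qed.

End PolynomialsOnSphere.

(** * Functions on the sphere *)

Lemma continuous_big_sum (R : realType) (T : topologicalType) (I : Type)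
    (r : seq I) (F : I -> T -> R) :
  (forall i, continuous (F i)) -> continuous (fun x => \sum_(i <- r) F i x).
Proof.
move=> cF; elim: r => [|i r IH] x.
  by under eq_fun do rewrite big_nil; exact: cvg_cst.
by under eq_fun do rewrite big_cons; exact: cvgD (cF i x) (IH x).
Qed.

Lemma continuous_big_prod (R : realType) (T : topologicalType) (I : Type)
    (r : seq I) (F : I -> T -> R) :
  (forall i, continuous (F i)) -> continuous (fun x => \prod_(i <- r) F i x).
Proof.
move=> cF; elim: r => [|i r IH] x.
  by under eq_fun do rewrite big_nil; exact: cvg_cst.
by under eq_fun do rewrite big_cons; exact: cvgM (cF i x) (IH x).
Qed.

Section SphereTopology.
Context (R : realType) (d : nat).
Local Notation V := 'rV[R]_d.+1.
Local Notation S := (sphere R d).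
Implicit Types f g : V -> R.

Definition sphere_continuous f : Prop := {within S, continuous f}.

Lemma coordX_continuous (n k : nat) (i : 'I_n.+1) :
  continuous (fun x : 'rV[R]_n.+1 => x ord0 i ^+ k).
Proof.
move=> x; apply: (@continuous_comp _ _ _ (fun x : 'rV[R]_n.+1 => x ord0 i)
  (fun t => t ^+ k)); first exact: coord_continuous.
exact: exprn_continuous.
Qed.

Lemma enorm_continuous (n : nat) : continuous (@enorm R n.+1).
Proof.
move=> x; apply: (@continuous_comp _ _ _ (fun x : 'rV[R]_n.+1 => \sum_i x ord0 i ^+ 2)
  (@Num.sqrt R)); last exact: sqrt_continuous.
by apply: continuous_big_sum => i; exact: coordX_continuous.
Qed.

Lemma sphere_closed : closed S.
Proof.
have -> : S = @enorm R d.+1 @^-1` [set 1] by [].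
apply: closed_comp => [x _|]; first exact: enorm_continuous.
exact: closed_eq.
Qed.

Lemma sphere_compact : compact S.
Proof.
apply: bounded_closed_compact sphere_closed.
exists 1; split; first exact: num_real.
move=> M M1 x Sx; apply: le_trans (ltW M1); rewrite /Num.norm /= mx_normrE.
apply: bigmax_le => // -[i j] _ /=; rewrite (ord1 i).
rewrite -(@ler_pXn2r _ 2) ?nnegrE // expr1n -(sphere_sum_sqr Sx).
rewrite real_normK ?num_real // (bigD1 j) //= lerDl sumr_ge0 // => k _.
exact: sqr_ge0.
Qed.

Lemma sphere_continuous_cst (c : R) : sphere_continuous (fun=> c).
Proof. by move=> x; exact: cvg_cst. Qed.

Lemma sphere_continuousD f g : sphere_continuous f -> sphere_continuous g ->
  sphere_continuous (fun x => f x + g x).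
Proof. by move=> cf cg x; exact: cvgD (cf x) (cg x). Qed.

Lemma sphere_continuousM f g : sphere_continuous f -> sphere_continuous g ->
  sphere_continuous (fun x => f x * g x).
Proof. by move=> cf cg x; exact: cvgM (cf x) (cg x). Qed.

Lemma sphere_continuousZ c f : sphere_continuous f ->
  sphere_continuous (fun x => c * f x).
Proof. by apply: sphere_continuousM => //; exact: sphere_continuous_cst. Qed.

Lemma sphere_continuousB f g : sphere_continuous f -> sphere_continuous g ->
  sphere_continuous (fun x => f x - g x).
Proof. by move=> cf cg x; exact: cvgB (cf x) (cg x). Qed.

Lemma sphere_continuous_sum (I : Type) (r : seq I) (F : I -> V -> R) :
  (forall i, sphere_continuous (F i)) ->
  sphere_continuous (fun x => \sum_(i <- r) F i x).
Proof.
move=> cF; exact: (@continuous_big_sum _ (subspace S)).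
Qed.

Lemma eq_sphere_continuous f g : (forall x, S x -> f x = g x) ->
  sphere_continuous f -> sphere_continuous g.
Proof. by move=> fg; apply: subspace_eq_continuous => x; rewrite inE; exact: fg. Qed.

Lemma sphere_continuous_meval (p : mpoly.mpoly d.+1 R) :
  sphere_continuous (fun x => mpoly.meval (x ord0) p).
Proof.
apply: continuous_subspaceT.
under eq_fun do rewrite mpoly.mevalE.
apply: continuous_big_sum => m x.
have cp : continuous (fun x : V => \prod_i x ord0 i ^+ (m i)).
  by apply: continuous_big_prod => i; exact: coordX_continuous.
exact: cvgM (cvg_cst _) (cp x).
Qed.

Lemma spherical_harmonic_continuous l f : spherical_harmonic l f -> sphere_continuous f.
Proof.
move=> [p [_ _ pf]]; apply: (eq_sphere_continuous _ (@sphere_continuous_meval p)).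
by move=> x Sx; rewrite pf.
Qed.

Lemma sphere_continuous_bounded f : sphere_continuous f ->
  exists2 b, 0 <= b & forall x, S x -> `|f x| <= b.
Proof.
move=> cf; have /compact_bounded[b [_ hb]] := continuous_compact cf sphere_compact.
exists (`|b| + 1); first by rewrite addr_ge0.
move=> x Sx; apply: (hb (`|b| + 1)); last by exists x.
by rewrite ltr_pwDr // ler_norm.
Qed.

Lemma measurable_sphere : measurable (S : set (borel_rV R d.+1)).
Proof.
rewrite -[S]setCK; apply: measurableC; apply: sub_sigma_algebra.
exact: closed_openC sphere_closed.
Qed.

Lemma sphere_continuous_measurable f : sphere_continuous f ->
  measurable_fun (S : set (borel_rV R d.+1)) (f : borel_rV R d.+1 -> R).
Proof.
move=> /continuousP cf.
apply: (measurability _ (RGenOpens.measurableE R)) => _ [_ [a [b ->] <-]].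
have oab : open (`]a, b[%classic : set R) by exact: interval_open.
have /open_subspaceP[U oU UE] := cf _ oab.
rewrite setIC -UE; apply: measurableI; last exact: measurable_sphere.
exact: sub_sigma_algebra.
Qed.

End SphereTopology.

Section SphereIntegral.
Context (R : realType) (d : nat) (mu : probability (borel_rV R d.+1) R).
Hypothesis mu1 : mu (sphere R d) = 1%E.
Local Notation V := 'rV[R]_d.+1.
Local Notation S := (sphere R d).
Implicit Types f g : V -> R.

Definition sphere_integral f : R := \int[mu]_(x in S) f x.
Local Notation I := sphere_integral.

Lemma sphere_integrable f : sphere_continuous f ->
  mu.-integrable S (EFin \o (f : borel_rV R d.+1 -> R)).
Proof.
move=> cf; have [b _ fb] := sphere_continuous_bounded cf.
apply: (@integrable_bounded _ _ _ _ _ _ b) => //; first exact: measurable_sphere.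
exact: sphere_continuous_measurable.
Qed.

Lemma eq_sphere_integral f g : (forall x, S x -> f x = g x) -> I f = I g.
Proof. by move=> fg; apply: eq_Rintegral => x; rewrite inE; exact: fg. Qed.

Lemma sphere_integral_cst (c : R) : I (fun=> c) = c.
Proof.
rewrite /I Rintegral_cst; last exact: measurable_sphere.
by rewrite (_ : _ S = 1%E) ?mulr1.
Qed.

Lemma sphere_integralD f g : sphere_continuous f -> sphere_continuous g ->
  I (fun x => f x + g x) = I f + I g.
Proof.
by move=> cf cg; apply: RintegralD;
  [exact: measurable_sphere|exact: sphere_integrable|exact: sphere_integrable].
Qed.

Lemma sphere_integralB f g : sphere_continuous f -> sphere_continuous g ->
  I (fun x => f x - g x) = I f - I g.
Proof.
by move=> cf cg; apply: RintegralB;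
  [exact: measurable_sphere|exact: sphere_integrable|exact: sphere_integrable].
Qed.

Lemma sphere_integralZ c f : sphere_continuous f ->
  I (fun x => c * f x) = c * I f.
Proof.
by move=> cf; apply: RintegralZl; [exact: measurable_sphere|exact: sphere_integrable].
Qed.

Lemma sphere_integral_sum (J : Type) (r : seq J) (F : J -> V -> R) :
  (forall i, sphere_continuous (F i)) ->
  I (fun x => \sum_(i <- r) F i x) = \sum_(i <- r) I (F i).
Proof.
move=> cF; elim: r => [|i r IH].
  by rewrite big_nil; under eq_fun do rewrite big_nil; exact: sphere_integral_cst.
rewrite big_cons -IH -sphere_integralD //; last exact: sphere_continuous_sum.
by under eq_fun do rewrite big_cons.
Qed.

Lemma sphere_integral_ge0 f : (forall x, S x -> 0 <= f x) -> 0 <= I f.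
Proof. by move=> f0; exact: Rintegral_ge0. Qed.

Lemma sphere_integral_le f g : sphere_continuous f -> sphere_continuous g ->
  (forall x, S x -> f x <= g x) -> I f <= I g.
Proof.
by move=> cf cg fg; apply: le_Rintegral => //;
  [exact: measurable_sphere|exact: sphere_integrable|exact: sphere_integrable].
Qed.

Lemma sphere_integral_cvg (F : nat -> V -> R) g (b : R) :
  (forall n, sphere_continuous (F n)) -> sphere_continuous g ->
  (forall n x, S x -> `|F n x| <= b) ->
  (forall x, S x -> F ^~ x @ \oo --> g x) -> (fun n => I (F n)) @ \oo --> I g.
Proof.
move=> cF cg Fb Fg.
have mS := @measurable_sphere R d.
have [|||||_ _] := @dominated_convergence _ (borel_rV R d.+1) R mu S mS
  (fun n x => (F n x)%:E) (fun x => (g x)%:E) (fun=> b%:E).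
- by move=> n; apply/measurable_EFinP; exact: sphere_continuous_measurable.
- by apply/measurable_EFinP; exact: sphere_continuous_measurable.
- apply: aeW => x Sx; apply: cvg_EFin; first by near=> n.
  exact: Fg.
- apply: (@integrable_bounded _ _ _ _ _ (fun=> b) `|b|) => //.
- by apply: aeW => x n Sx; rewrite lee_fin; exact: Fb.
move=> h.
apply: (@fine_cvg _ _ _ _ (fun n => \int[mu]_(x in S) (F n x)%:E)%E).
rewrite fineK //; apply: integrable_fin_num => //; exact: sphere_integrable.
Unshelve. all: by end_near.
Qed.

Lemma L2normE f : sphere_continuous f ->
  L2norm mu f = (Num.sqrt (I (fun x => f x ^+ 2)))%:E.
Proof.
move=> cf; have cf2 : sphere_continuous (fun x => f x ^+ 2) by exact: sphere_continuousM.
rewrite /L2norm unlock.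
have -> : (\int[mu]_x (`|((fun x => (f x)%:E) \_ S) x| `^ 2) =
    \int[mu]_(x in S) (f x ^+ 2)%:E)%E.
  rewrite [RHS]integral_mkcond; apply: eq_integral => x _.
  rewrite !patchE; case: ifPn => _ /=; last by rewrite normr0 powR0.
  by rewrite powR_mulrn ?normr_ge0 // real_normK ?num_real.
rewrite -[(\int[mu]_(x in S) _)%E]fineK; last first.
  by apply: integrable_fin_num; [exact: measurable_sphere|exact: (sphere_integrable cf2)].
rewrite poweR_EFin powR12_sqrt //; apply: Rintegral_ge0 => x _; exact: sqr_ge0.
Qed.

Lemma sphere_continuous_in_L2 f : sphere_continuous f -> in_L2 mu f.
Proof.
move=> cf; split; first exact: sphere_continuous_measurable.
by rewrite L2normE // ltry.
Qed.

End SphereIntegral.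

(** * Fourier coefficients *)

Section HarmonicBasis.
Context (R : realType) (d : nat) (mu : probability (borel_rV R d.+1) R).
Hypothesis mu1 : mu (sphere R d) = 1%E.
Context (Z : nat -> nat) (Y : forall l : nat, 'I_(Z l) -> 'rV[R]_d.+1 -> R).
Hypothesis hY : spherical_harmonic_basis mu Y.
Local Notation V := 'rV[R]_d.+1.
Local Notation S := (sphere R d).
Local Notation I := (sphere_integral mu).
Local Notation coefs := (forall l : nat, 'I_(Z l) -> R).
Implicit Types (f g : V -> R) (a b c : coefs) (l J L : nat).

Definition combination c L : V -> R :=
  fun x => \sum_(l < L) \sum_(k < Z l) c l k * Y k x.

Definition degree_energy f l : R := \sum_(k < Z l) fourier_coef mu Y f k ^+ 2.

Lemma degree_energy_ge0 f l : 0 <= degree_energy f l.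
Proof. by apply: sumr_ge0 => k _; exact: sqr_ge0. Qed.

Lemma basis_continuous l (k : 'I_(Z l)) : sphere_continuous (Y k).
Proof. by have [h _ _ _] := hY; exact: spherical_harmonic_continuous (h l k). Qed.
Hint Resolve basis_continuous : core.

Lemma combination_continuous c L : sphere_continuous (combination c L).
Proof.
by do 2 (apply: sphere_continuous_sum => ?); exact: sphere_continuousZ.
Qed.
Hint Resolve combination_continuous : core.

Lemma fourier_coefD f g l (k : 'I_(Z l)) :
  sphere_continuous f -> sphere_continuous g ->
  fourier_coef mu Y (fun x => f x + g x) k =
  fourier_coef mu Y f k + fourier_coef mu Y g k.
Proof.
move=> cf cg; rewrite /fourier_coef /inner_L2.
under eq_Rintegral do rewrite mulrDl.
by apply: sphere_integralD => //; exact: sphere_continuousM.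
Qed.

Lemma fourier_coefZ (e : R) f l (k : 'I_(Z l)) : sphere_continuous f ->
  fourier_coef mu Y (fun x => e * f x) k = e * fourier_coef mu Y f k.
Proof.
move=> cf; rewrite /fourier_coef /inner_L2.
under eq_Rintegral do rewrite -mulrA.
by apply: sphere_integralZ => //; exact: sphere_continuousM.
Qed.

Lemma fourier_coef_sum (J : Type) (r : seq J) (F : J -> V -> R) l (k : 'I_(Z l)) :
  (forall i, sphere_continuous (F i)) ->
  fourier_coef mu Y (fun x => \sum_(i <- r) F i x) k =
  \sum_(i <- r) fourier_coef mu Y (F i) k.
Proof.
move=> cF; rewrite /fourier_coef /inner_L2.
under eq_Rintegral do rewrite mulr_suml.
by apply: sphere_integral_sum => // i; exact: sphere_continuousM.
Qed.

Lemma eq_fourier_coef f g l (k : 'I_(Z l)) : (forall x, S x -> f x = g x) ->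
  fourier_coef mu Y f k = fourier_coef mu Y g k.
Proof. by move=> fg; apply: eq_sphere_integral => x Sx; rewrite fg. Qed.

Lemma inner_combination f c L : sphere_continuous f ->
  I (fun x => f x * combination c L x) =
  \sum_(l < L) \sum_(k < Z l) c l k * fourier_coef mu Y f k.
Proof.
move=> cf; rewrite /combination.
transitivity (I (fun x => \sum_(l < L) \sum_(k < Z l) c l k * (f x * Y k x))).
  apply: eq_sphere_integral => x _; rewrite mulr_sumr; apply: eq_bigr => l _.
  by rewrite mulr_sumr; apply: eq_bigr => k _; rewrite mulrCA.
have cc l (k : 'I_(Z l)) : sphere_continuous (fun x => f x * Y k x).
  exact: sphere_continuousM.
rewrite sphere_integral_sum // => [|l]; last first.
  by apply: sphere_continuous_sum => k; exact: sphere_continuousZ.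
apply: eq_bigr => l _; rewrite sphere_integral_sum // => [|k].
  by apply: eq_bigr => k _; rewrite sphere_integralZ.
exact: sphere_continuousZ.
Qed.

Lemma fourier_coef_combination c L l (k : 'I_(Z l)) :
  fourier_coef mu Y (combination c L) k = if (l < L)%N then c l k else 0.
Proof.
have [_ orth _ _] := hY.
rewrite /fourier_coef /inner_L2.
transitivity (I (fun x => Y k x * combination c L x)).
  by apply: eq_sphere_integral => x _; rewrite mulrC.
rewrite inner_combination //.
have E l' (k' : 'I_(Z l')) : fourier_coef mu Y (Y k) k' =
    if (l == l') && (k == k' :> nat) then 1 else 0 by exact: orth.
have [lL|lL] := ltnP l L; last first.
  apply: big1 => l' _; apply: big1 => k' _; rewrite E.
  have [ll|_] := eqVneq l l'; last by rewrite mulr0.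
  by exfalso; have := ltn_ord l'; rewrite -ll ltnNge lL.
rewrite (bigD1 (Ordinal lL)) //= [X in _ + X]big1 ?addr0 => [|l' ll]; last first.
  apply: big1 => k' _; rewrite E (_ : (l == l') = false) ?mulr0 //.
  by apply/negbTE; rewrite eq_sym.
rewrite (bigD1 k) //= big1 ?addr0 => [|k' kk]; first by rewrite E !eqxx mulr1.
by rewrite E eqxx /= (inj_eq (@ord_inj _)) eq_sym (negPf kk) mulr0.
Qed.

Lemma energy_combination c L :
  I (fun x => combination c L x ^+ 2) = \sum_(l < L) \sum_(k < Z l) c l k ^+ 2.
Proof.
rewrite inner_combination //.
apply: eq_bigr => l _; apply: eq_bigr => k _.
by rewrite fourier_coef_combination ltn_ord expr2.
Qed.

Definition partial_sum f L : V -> R := combination (fun l k => fourier_coef mu Y f k) L.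

Lemma energy_sub_combination f c L : sphere_continuous f ->
  I (fun x => (f x - combination c L x) ^+ 2) =
  I (fun x => f x ^+ 2) - 2 * I (fun x => f x * combination c L x) +
  \sum_(l < L) \sum_(k < Z l) c l k ^+ 2.
Proof.
move=> cf.
have c1 : sphere_continuous (fun x => f x ^+ 2) by exact: sphere_continuousM.
have c2 : sphere_continuous (fun x => f x * combination c L x).
  exact: sphere_continuousM.
have c3 : sphere_continuous (fun x => combination c L x ^+ 2).
  exact: sphere_continuousM.
rewrite -energy_combination -sphere_integralZ // -sphere_integralB //; last first.
  exact: sphere_continuousZ.
rewrite -sphere_integralD //; last by apply: sphere_continuousB => //; exact: sphere_continuousZ.
by apply: eq_sphere_integral => x _; ring.
Qed.

Lemma energy_remainder f L : sphere_continuous f ->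
  I (fun x => (f x - partial_sum f L x) ^+ 2) =
  I (fun x => f x ^+ 2) - \sum_(l < L) degree_energy f l.
Proof.
move=> cf; rewrite energy_sub_combination // inner_combination //.
rewrite (_ : \sum_(l < L) \sum_(k < Z l) _ = \sum_(l < L) degree_energy f l); last first.
  by apply: eq_bigr => l _; apply: eq_bigr => k _; rewrite expr2.
by ring.
Qed.

Lemma Bessel f L : sphere_continuous f ->
  \sum_(l < L) degree_energy f l <= I (fun x => f x ^+ 2).
Proof.
move=> cf; rewrite -subr_ge0 -energy_remainder //.
by apply: sphere_integral_ge0 => x _; exact: sqr_ge0.
Qed.

(** Completeness concerns the norm of the remainder, whose square is the defect in Bessel's
    inequality. *)
Lemma Parseval f : sphere_continuous f ->
  (fun L => \sum_(l < L) degree_energy f l) @ \oo --> I (fun x => f x ^+ 2).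
Proof.
move=> cf; have [_ _ _ complete] := hY.
have := complete _ (sphere_continuous_in_L2 mu cf).
have cr L : sphere_continuous (fun x => f x - partial_sum f L x).
  by apply: sphere_continuousB => //; exact: combination_continuous.
rewrite (_ : (fun L => _) = (fun L => (Num.sqrt (I (fun x => f x ^+ 2) -
    \sum_(l < L) degree_energy f l))%:E)); last first.
  by apply/funext => L; rewrite -energy_remainder // -L2normE.
move=> /fine_cvg /=.
set r := (r in r @ \oo --> _) => h.
have h2 : (fun L => r L * r L) @ \oo --> (0 * 0 : R) by exact: (cvgM h h).
rewrite mulr0 in h2.
have h3 : (fun L => I (fun x => f x ^+ 2) - r L * r L) @ \oo -->
    I (fun x => f x ^+ 2) - 0 by exact: cvgB (cvg_cst _) h2.
rewrite subr0 in h3; apply: cvg_trans h3; apply: near_eq_cvg; apply: nearW => L.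
by rewrite /r /= -expr2 sqr_sqrtr ?subr_ge0 ?Bessel // opprB addrC subrK.
Qed.

Lemma energy_le f (B : R) : sphere_continuous f ->
  (forall L, \sum_(l < L) degree_energy f l <= B) -> I (fun x => f x ^+ 2) <= B.
Proof.
by move=> cf h; apply: (ler_cvg_to (Parseval cf) (cvg_cst B)); exact: nearW.
Qed.

Lemma fourier_coef_harmonic e h l (k : 'I_(Z l)) : spherical_harmonic e h ->
  e != l -> fourier_coef mu Y h k = 0.
Proof.
have [_ orth span _] := hY.
move=> /span[c hc] el; rewrite (eq_fourier_coef _ hc).
rewrite fourier_coef_sum // => [|i]; last exact: sphere_continuousZ.
rewrite big1 // => i _; rewrite fourier_coefZ // [X in _ * X](_ : _ = 0) ?mulr0 //.
by apply: etrans (orth _ _ _ _) _; rewrite (negPf el).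
Qed.

(* A product of harmonics of degrees [l1] and [l2] is a homogeneous polynomial
   of degree [l1 + l2], hence on the sphere a sum of harmonics of lower or
   equal degrees. *)
Lemma fourier_coef_basisM l1 l2 l (k1 : 'I_(Z l1)) (k2 : 'I_(Z l2)) (k : 'I_(Z l)) :
  (l1 + l2 < l)%N -> fourier_coef mu Y (fun x => Y k1 x * Y k2 x) k = 0.
Proof.
have [harm _ _ _] := hY.
move=> ll; have [p1 [hp1 _ E1]] := harm l1 k1; have [p2 [hp2 _ E2]] := harm l2 k2.
have [g hg gE] := homog_sphere_decomp (mpoly.dhomogM hp1 hp2).
rewrite (@eq_fourier_coef _ (fun x => \sum_(e < (l1 + l2).+1) g e x)); last first.
  by move=> x Sx; rewrite -gE // mpoly.mevalM E1 // E2.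
rewrite fourier_coef_sum // => [|i]; last exact: spherical_harmonic_continuous (hg i).
rewrite big1 // => e _; apply: fourier_coef_harmonic (hg e) _.
by rewrite neq_ltn (leq_ltn_trans _ ll) // -ltnS.
Qed.

Lemma fourier_coef_combinationM a b J l (k : 'I_(Z l)) : (J.*2 <= l.+1)%N ->
  fourier_coef mu Y (fun x => combination a J x * combination b J x) k = 0.
Proof.
move=> Jl.
rewrite (@eq_fourier_coef _ (fun x => \sum_(l1 < J) \sum_(k1 < Z l1)
   \sum_(l2 < J) \sum_(k2 < Z l2) (a l1 k1 * b l2 k2) * (Y k1 x * Y k2 x))); last first.
  move=> x _; rewrite /combination mulr_suml; apply: eq_bigr => l1 _.
  rewrite mulr_suml; apply: eq_bigr => k1 _; rewrite mulr_sumr; apply: eq_bigr => l2 _.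
  by rewrite mulr_sumr; apply: eq_bigr => k2 _; ring.
have cY l1 l2 (k1 : 'I_(Z l1)) (k2 : 'I_(Z l2)) :
  sphere_continuous (fun x => Y k1 x * Y k2 x) by exact: sphere_continuousM.
rewrite fourier_coef_sum => [|l1]; last first.
  do 3 (apply: sphere_continuous_sum => ?); exact: sphere_continuousZ.
rewrite big1 // => l1 _; rewrite fourier_coef_sum => [|k1]; last first.
  do 2 (apply: sphere_continuous_sum => ?); exact: sphere_continuousZ.
rewrite big1 // => k1 _; rewrite fourier_coef_sum => [|l2]; last first.
  by apply: sphere_continuous_sum => ?; exact: sphere_continuousZ.
rewrite big1 // => l2 _; rewrite fourier_coef_sum => [|k2]; last exact: sphere_continuousZ.
rewrite big1 // => k2 _; rewrite fourier_coefZ // fourier_coef_basisM ?mulr0 //.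
(* Both degrees are at most J - 1, so l1 + l2 + 2 <= 2 J <= l + 1. *)
rewrite -ltnS; apply: leq_trans Jl; rewrite -addnn -addSn -addnS leq_add //.
Qed.

(** Powers of the squared radius equal 1 on the sphere and raise degrees by even amounts. All
    harmonics of one parity are thus restrictions of polynomials of one degree; the factor 2 counts
    the parities. *)
Lemma sum_dim_le L : (\sum_(l < L) Z l <= 2 * L.+1 ^ d)%N.
Proof.
have [harm orth _ _] := hY.
have [->|L0] := posnP L; first by rewrite big_ord0.
pose T := {l : 'I_L & 'I_(Z l)}.
have -> : (\sum_(l < L) Z l = #|{: T}|)%N.
  rewrite card_tagged sumnE big_map big_enum /=.
  by apply: eq_bigr => l _; rewrite card_ord.
pose A e := [pred i : T | odd (tag i) == e].
have cardA e : (#|A e| <= L.+1 ^ d)%N.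
  (* The largest degree up to L of parity e, so that D minus any degree of that parity is even. *)
  pose D := if odd L == e then L else L.-1.
  have DL : (D <= L)%N by rewrite /D; case: ifP => // _; exact: leq_pred.
  have oD : odd D = e.
    rewrite /D; case: eqP => // /eqP; case: L L0 {T A D DL} => //= L' _.
    by case: e; case: odd.
  have lD (i : T) : odd (tag i) = e -> (tag i <= D)%N.
    move=> oi; rewrite /D; case: eqP => [_|_]; first exact: ltnW.
    by rewrite -ltnS prednK.
  rewrite -card_sig; apply: leq_trans (_ : D.+1 ^ d <= _)%N; last first.
    by case: (d) => // d'; rewrite leq_exp2r.
  apply: (@card_indep_homog _ _ _ _ (fun i => Y (tagged (val i)))).
    move=> [i /= /eqP oi]; have [p [hp _ pE]] := harm _ (tagged i).
    exists (sqradius R d ^+ (D - tag i)./2 * p).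
      rewrite -[D](subnK (lD i oi)); apply: mpoly.dhomogM => //.
      rewrite -[X in mpoly.ishomog1 X](odd_double_half (D - tag i)) oddB ?lD // oD oi addbb.
      by rewrite addnK -mul2n; apply: mpoly.dhomogMn; exact: sqradius_homog.
    by move=> x Sx; rewrite mpoly.mevalM meval_sqradiusX // mul1r pE.
  move=> c c0 j.
  (* Integrating the vanishing combination against its j-th member isolates [c j] by
     orthonormality. *)
  have : I (fun x => \sum_i c i * (Y (tagged (val i)) x * Y (tagged (val j)) x)) = 0.
    transitivity (I (fun=> 0)); last exact: sphere_integral_cst.
    apply: eq_sphere_integral => x Sx.
    apply: etrans (_ : (\sum_i c i * Y (tagged (val i)) x) * Y (tagged (val j)) x = 0).
      by rewrite mulr_suml; apply: eq_bigr => i _; rewrite mulrA.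
    by rewrite c0 // mul0r.
  rewrite sphere_integral_sum // => [|i]; last first.
    by apply: sphere_continuousZ; exact: sphere_continuousM.
  have E i : I (fun x => c i * (Y (tagged (val i)) x * Y (tagged (val j)) x)) =
      if i == j then c i else 0.
    rewrite sphere_integralZ //; last exact: sphere_continuousM.
    rewrite [X in _ * X](_ : _ = if i == j then 1 else 0); last first.
      apply: etrans (orth _ _ _ _) _; congr (if _ then _ else _).
      rewrite -(inj_eq val_inj); case: (val i) (val j) => [li ki] [lj kj] /=.
      rewrite (inj_eq val_inj); apply/andP/eqP => [[/eqP ll /eqP kk]|e0].
        by move: kj kk; rewrite -ll => kj /ord_inj ->.
      by split; apply/eqP; [exact: (congr1 (fun u : T => tag u) e0)|
        exact: (congr1 (fun u : T => nat_of_ord (tagged u)) e0)].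
    by case: ifP => _; rewrite ?mulr1 ?mulr0.
  under eq_bigr do rewrite E.
  by rewrite -big_mkcond big_pred1_eq.
have -> : #|{: T}| = (#|A true| + #|A false|)%N.
  rewrite -(cardID (A true) predT); congr (_ + _)%N; apply: eq_card => i.
  by rewrite !inE andbT; case: odd.
by rewrite mul2n -addnn leq_add.
Qed.

(** With J half of i rounded up, f u = f (u - u_J) + (f - f_J) u_J + f_J u_J. The last product has
    degree at most 2 J - 2 < i; the other two are bounded by a supremum times a tail energy. *)
Lemma tail_energy_productM f b (F U : R) (i n M : nat) :
  sphere_continuous f -> (forall x, S x -> `|f x| <= F) ->
  (forall J x, S x -> `|combination b J x| <= U) -> (uphalf i <= M)%N ->
  \sum_(i <= l < n) degree_energy (fun x => f x * combination b M x) l <=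
  2 * F ^+ 2 * \sum_(uphalf i <= l < M) \sum_(k < Z l) b l k ^+ 2 +
  2 * U ^+ 2 * (I (fun x => f x ^+ 2) - \sum_(l < uphalf i) degree_energy f l).
Proof.
move=> cf fF bU; set J := uphalf i => JM.
pose fJ := partial_sum f J.
have cfJ : sphere_continuous fJ by exact: combination_continuous.
pose uJ := combination b J; pose u := combination b M.
have cu : sphere_continuous u by exact: combination_continuous.
have cuJ : sphere_continuous uJ by exact: combination_continuous.
pose G x := f x * (u x - uJ x) + (f x - fJ x) * uJ x.
have c1 : sphere_continuous (fun x => u x - uJ x) by exact: sphere_continuousB.
have c2 : sphere_continuous (fun x => f x - fJ x) by exact: sphere_continuousB.
have cG : sphere_continuous G.
  by apply: sphere_continuousD; exact: sphere_continuousM.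
have energyG l : (i <= l)%N -> degree_energy (fun x => f x * u x) l = degree_energy G l.
  move=> il; apply: eq_bigr => k _; congr (_ ^+ 2).
  rewrite (@eq_fourier_coef _ (fun x => G x + fJ x * uJ x)); last first.
    by move=> x _; rewrite /G; ring.
  rewrite fourier_coefD //; last exact: sphere_continuousM.
  rewrite fourier_coef_combinationM ?addr0 //.
  by rewrite -geq_half_double /J uphalfE half_leq.
rewrite (eq_big_nat _ _ (F2 := degree_energy G)); last first.
  by move=> l /andP[il _]; exact: energyG.
apply: (@le_trans _ _ (I (fun x => G x ^+ 2))).
  apply: le_trans (Bessel n cG).
  rewrite big_geq_mkord /= [leRHS](bigID (fun l : 'I_n => (i <= l)%N)) /= lerDl.
  by apply: sumr_ge0 => l _; exact: degree_energy_ge0.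
have c3 : sphere_continuous (fun x => (u x - uJ x) ^+ 2) by exact: sphere_continuousM.
have c4 : sphere_continuous (fun x => (f x - fJ x) ^+ 2) by exact: sphere_continuousM.
apply: (@le_trans _ _ (I (fun x => 2 * F ^+ 2 * (u x - uJ x) ^+ 2 +
    2 * U ^+ 2 * (f x - fJ x) ^+ 2))).
  apply: sphere_integral_le; first exact: sphere_continuousM.
    by apply: sphere_continuousD; exact: sphere_continuousZ.
  move=> x Sx; rewrite /G.
  have f2 : f x ^+ 2 <= F ^+ 2.
    by rewrite -real_normK ?num_real // lerXn2r ?nnegrE // ?fF // (le_trans _ (fF _ Sx)).
  have u2 : uJ x ^+ 2 <= U ^+ 2.
    by rewrite -real_normK ?num_real // lerXn2r ?nnegrE // ?bU // (le_trans _ (bU J _ Sx)).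
  have h1 := ler_wpM2r (sqr_ge0 (u x - uJ x)) f2.
  have h2 := ler_wpM2r (sqr_ge0 (f x - fJ x)) u2.
  have h3 := sqr_ge0 (f x * (u x - uJ x) - (f x - fJ x) * uJ x).
  move: h1 h2 h3; move: (u x - uJ x) (f x - fJ x) (f x) (uJ x) => p q r t h1 h2 h3.
  nra.
rewrite sphere_integralD; [|exact: sphere_continuousZ|exact: sphere_continuousZ].
rewrite !sphere_integralZ // energy_remainder //.
rewrite (_ : I (fun x => (u x - uJ x) ^+ 2) =
  \sum_(J <= l < M) \sum_(k < Z l) b l k ^+ 2) //.
rewrite energy_sub_combination // energy_combination.
rewrite (_ : I (fun x => u x * combination b J x) =
  \sum_(l < J) \sum_(k < Z l) b l k ^+ 2); last first.
  rewrite inner_combination //; apply: eq_bigr => l _; apply: eq_bigr => k _.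
  by rewrite fourier_coef_combination (leq_trans (ltn_ord l) JM) expr2.
rewrite -(big_mkord xpredT (fun l => \sum_(k < Z l) b l k ^+ 2)).
rewrite -(big_mkord xpredT (fun l => \sum_(k < Z l) b l k ^+ 2)).
by rewrite (big_cat_nat (n := J) (p := M)) //=; ring.
Qed.

(* The algebra property of the Sobolev space, for the product of [f] with a
   finite combination; [U] bounds all truncations of the second factor. *)
Lemma weighted_energy_productM f b (w : nat -> R) (A B F U : R) (n M : nat) :
  sphere_continuous f -> (forall x, S x -> `|f x| <= F) ->
  (forall J x, S x -> `|combination b J x| <= U) -> (n <= M)%N ->
  (forall i, 0 <= increment w i) -> (forall l, w l.*2 <= A * w l) ->
  (forall L, \sum_(l < L) w l * degree_energy f l <= B) -> 0 <= A ->
  \sum_(l < n) w l * degree_energy (fun x => f x * combination b M x) l <=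
  2 * A * (F ^+ 2 * \sum_(l < M) w l * \sum_(k < Z l) b l k ^+ 2 + U ^+ 2 * B).
Proof.
move=> cf fF bU nM w0 wA fB A0.
rewrite sum_mul_Abel.
pose tf J := I (fun x => f x ^+ 2) - \sum_(l < J) degree_energy f l.
have iM (i : 'I_n) : (uphalf i <= M)%N.
  apply: leq_trans nM; apply: leq_trans (ltnW (ltn_ord i)).
  by rewrite leq_uphalf_double -addnn leq_addr.
apply: (@le_trans _ _ (\sum_(i < n) increment w i *
  (2 * F ^+ 2 * \sum_(uphalf i <= l < M) \sum_(k < Z l) b l k ^+ 2 +
   2 * U ^+ 2 * tf (uphalf i)))).
  by apply: ler_sum => i _; apply: ler_wpM2l => //; exact: tail_energy_productM.
have -> : \sum_(i < n) increment w i *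
  (2 * F ^+ 2 * (\sum_(uphalf i <= l < M) \sum_(k < Z l) b l k ^+ 2) +
   2 * U ^+ 2 * tf (uphalf i)) =
  2 * F ^+ 2 * (\sum_(i < n) increment w i *
     \sum_(uphalf i <= l < M) \sum_(k < Z l) b l k ^+ 2) +
  2 * U ^+ 2 * \sum_(i < n) increment w i * tf (uphalf i).
  by rewrite !mulr_sumr -big_split /=; apply: eq_bigr => i _; ring.
have h1 := sum_increment_uphalf_le
  (e := fun l => \sum_(k < Z l) b l k ^+ 2) n M w0 wA
  (fun l => sumr_ge0 _ (fun k _ => sqr_ge0 (b l k))).
(* [tf] is an infinite tail while [sum_increment_uphalf_le] handles finite ones: cut at M' and let
   the rest [s * tf M'] tend to 0 by Parseval. *)
have h2 : \sum_(i < n) increment w i * tf (uphalf i) <= A * B.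
  pose s := \sum_(i < n) increment w i.
  have lim0 : (fun M' => A * B + s * tf M') @ \oo --> A * B + s * (I (fun x => f x ^+ 2) - I (fun x => f x ^+ 2)).
    apply: cvgD; first exact: cvg_cst.
    apply: cvgM; first exact: cvg_cst.
    by apply: cvgB; [exact: cvg_cst|exact: Parseval].
  rewrite subrr mulr0 addr0 in lim0.
  apply: (ler_cvg_to (cvg_cst _) lim0).
  exists n => // M' /= nM'.
  have -> : \sum_(i < n) increment w i * tf (uphalf i) =
      \sum_(i < n) increment w i * (\sum_(uphalf i <= l < M') degree_energy f l) + s * tf M'.
    rewrite /s mulr_suml -big_split /=; apply: eq_bigr => i _.
    have iM' : (uphalf i <= M')%N.
      apply: leq_trans nM'; apply: leq_trans (ltnW (ltn_ord i)).
      by rewrite leq_uphalf_double -addnn leq_addr.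
    rewrite /tf -(big_mkord xpredT) -[\sum_(l < M') _](big_mkord xpredT).
    by rewrite (big_cat_nat (m := 0%N) (n := uphalf i) (p := M')) //=; ring.
  rewrite lerD2r; apply: le_trans (sum_increment_uphalf_le _ _ w0 wA (degree_energy_ge0 f)) _.
  exact: ler_wpM2l.
have := ler_wpM2l (sqr_ge0 F) h1; have := ler_wpM2l (sqr_ge0 U) h2.
lra.
Qed.

(** * Christoffel sums and kernels with nonnegative coefficients *)

(** The diagonal of the reproducing kernel of the harmonics of degree l. *)
Definition christoffel l (x : V) : R := \sum_(k < Z l) Y k x ^+ 2.

Lemma christoffel_ge0 l x : 0 <= christoffel l x.
Proof. by apply: sumr_ge0 => k _; exact: sqr_ge0. Qed.

Lemma christoffel_continuous l : sphere_continuous (christoffel l).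
Proof. by apply: sphere_continuous_sum => k; exact: sphere_continuousM. Qed.

Lemma integral_christoffel l : I (christoffel l) = (Z l)%:R.
Proof.
have [_ orth _ _] := hY.
rewrite sphere_integral_sum // => [|k]; last exact: sphere_continuousM.
under eq_bigr => k _.
  rewrite (_ : I _ = 1); last by apply: etrans (orth l l k k) _; rewrite !eqxx.
  over.
by rewrite sumr_const card_ord.
Qed.

Section Kernel.
Context (K : V -> V -> R) (a : nat -> R) (kappa : R).
Hypothesis Kcont : forall y, S y -> sphere_continuous (K ^~ y).
Hypothesis Kdiag : forall x, S x -> K x x = kappa.
Hypothesis Ka : fourier_legendre Y K a.
Hypothesis a0 : forall l, 0 <= a l.

(** On the diagonal all terms of the series are nonnegative, so the partial sums increase to
    kappa. *)
Lemma sum_christoffel_le x L : S x -> \sum_(l < L) a l * christoffel l x <= kappa.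
Proof.
move=> Sx; have := Ka Sx Sx; rewrite Kdiag // => h.
apply: (ler_cvg_to (cvg_cst _) h).
exists L => // L' /= LL'.
rewrite -(big_mkord xpredT (fun l => a l * christoffel l x)).
rewrite -[leRHS](big_mkord xpredT (fun l => a l * \sum_(k < Z l) Y k x * Y k x)).
rewrite [leRHS](big_cat_nat (n := L)) //= lerDl sumr_ge0 // => l _.
by rewrite mulr_ge0 // christoffel_ge0.
Qed.

(** Off the diagonal, 2 |Y(x) Y(y)| <= Y(x)^2 + Y(y)^2 reduces to the diagonal sums. The bound
    serves as the dominating constant for integrating the series termwise. *)
Lemma kernel_partial_sum_le x y L : S x -> S y ->
  `|combination (fun l k => a l * Y k y) L x| <= kappa.
Proof.
move=> Sx Sy.
have h : \sum_(l < L) \sum_(k < Z l) a l * (Y k x ^+ 2 + Y k y ^+ 2) <= 2 * kappa.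
  have -> : \sum_(l < L) \sum_(k < Z l) a l * (Y k x ^+ 2 + Y k y ^+ 2) =
      \sum_(l < L) a l * christoffel l x + \sum_(l < L) a l * christoffel l y.
    rewrite -big_split; apply: eq_bigr => l _.
    by rewrite /= -mulrDr /christoffel -big_split mulr_sumr.
  by have := sum_christoffel_le L Sx; have := sum_christoffel_le L Sy; lra.
apply: (@le_trans _ _ (\sum_(l < L) \sum_(k < Z l) a l * (Y k x ^+ 2 + Y k y ^+ 2) / 2)).
  apply: le_trans (ler_norm_sum _ _ _) _; apply: ler_sum => l _.
  apply: le_trans (ler_norm_sum _ _ _) _; apply: ler_sum => k _.
  rewrite -mulrA -mulrA normrM (ger0_norm (a0 l)) ler_wpM2l //.
  have h1 := sqr_ge0 (Y k y - Y k x); have h2 := sqr_ge0 (Y k y + Y k x).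
  by rewrite ler_norml; apply/andP; split; nra.
by under eq_bigr do rewrite -mulr_suml; rewrite -mulr_suml; lra.
Qed.

Lemma kernel_partial_sum_cvg x y : S x -> S y ->
  (fun L => combination (fun l k => a l * Y k y) L x) @ \oo --> K x y.
Proof.
move=> Sx Sy; have := Ka Sx Sy; rewrite /fourier_legendre.
have -> : (fun L => \sum_(l < L) a l * \sum_(k < Z l) Y k x * Y k y) =
  (fun L => combination (fun l k => a l * Y k y) L x).
  apply/funext => L; apply: eq_bigr => l _; rewrite mulr_sumr.
  by apply: eq_bigr => k _; ring.
by [].
Qed.

(** [fourier_legendre] only gives pointwise convergence; dominated convergence transfers it to the
    coefficients. *)
Lemma fourier_coef_kernel y l (k : 'I_(Z l)) : S y ->
  fourier_coef mu Y (K ^~ y) k = a l * Y k y.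
Proof.
move=> Sy; have [b b0 Yb] := sphere_continuous_bounded (@basis_continuous l k).
have := @sphere_integral_cvg _ _ mu
  (fun L x => combination (fun l k => a l * Y k y) L x * Y k x)
  (fun x => K x y * Y k x) (kappa * b).
move=> /(_ _ _ _ _) h.
have {}h : (fun L => fourier_coef mu Y (combination (fun l k => a l * Y k y) L) k) @ \oo
   --> fourier_coef mu Y (K ^~ y) k.
  apply: h => [L|x|L x Sx|x Sx].
  - exact: sphere_continuousM.
  - by apply: sphere_continuousM => //; exact: Kcont.
  - by rewrite normrM ler_pM // ?Yb // kernel_partial_sum_le.
  - by apply: cvgM; [exact: kernel_partial_sum_cvg|exact: cvg_cst].
apply: (cvg_unique _ h) => //.
apply: cvg_near_cst; exists l.+1 => // L /= lL.
by rewrite fourier_coef_combination lL.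
Qed.

(** The diagonal value is constant, hence equal to its mean, and averaging turns each Christoffel
    sum into the dimension [Z l]. *)
Lemma kappa_le (B : R) : (forall L, \sum_(l < L) a l * (Z l)%:R <= B) -> kappa <= B.
Proof.
move=> aB.
have h : (fun L => I (fun x => \sum_(l < L) a l * christoffel l x)) @ \oo --> I (fun=> kappa).
  apply: (@sphere_integral_cvg _ _ _ _ _ kappa) => [L|x|L x Sx|x Sx].
  - by apply: sphere_continuous_sum => l; apply: sphere_continuousZ; exact: christoffel_continuous.
  - exact: sphere_continuous_cst.
  - rewrite ger0_norm ?sum_christoffel_le // sumr_ge0 // => l _.
    by rewrite mulr_ge0 // christoffel_ge0.
  - by have := Ka Sx Sx; rewrite Kdiag.
rewrite sphere_integral_cst // in h.
apply: (ler_cvg_to h (cvg_cst B)); apply: nearW => L.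
rewrite sphere_integral_sum => // [|l]; last first.
  by apply: sphere_continuousZ; exact: christoffel_continuous.
apply: le_trans (aB L); apply: ler_sum => l _.
by rewrite sphere_integralZ ?integral_christoffel //; exact: christoffel_continuous.
Qed.

(** Only one factor of a_l^2 is bounded by A; the other rebuilds the diagonal sum. The energy is
    thus linear in kappa. *)
Lemma kernel_energy_le y (A : R) : S y -> (forall l, a l <= A) ->
  I (fun x => K x y ^+ 2) <= A * kappa.
Proof.
move=> Sy aA; have A0 : 0 <= A by exact: le_trans (a0 0) (aA 0).
apply: energy_le; first exact: Kcont.
move=> L; apply: (@le_trans _ _ (A * \sum_(l < L) a l * christoffel l y)); last first.
  by rewrite ler_wpM2l // sum_christoffel_le.
rewrite mulr_sumr; apply: ler_sum => l _.
rewrite /degree_energy; under eq_bigr do rewrite fourier_coef_kernel // exprMn.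
rewrite -mulr_sumr -/(christoffel l y) mulrA ler_wpM2r ?christoffel_ge0 //.
by rewrite expr2 ler_wpM2r.
Qed.

End Kernel.

(** Weighted Cauchy-Schwarz. For Sobolev weights it is the embedding into bounded functions, uniform
    in the truncation J. *)
Lemma combination_sqr_le b (w : nat -> R) J x : (forall l, 0 < w l) ->
  combination b J x ^+ 2 <=
  (\sum_(l < J) w l * \sum_(k < Z l) b l k ^+ 2) *
  \sum_(l < J) (w l)^-1 * christoffel l x.
Proof.
move=> w0; apply: discriminant_le.
  by apply: sumr_ge0 => l _; rewrite mulr_ge0 ?christoffel_ge0 // invr_ge0 ltW.
move=> t.
have -> : (\sum_(l < J) w l * \sum_(k < Z l) b l k ^+ 2) +
    2 * t * combination b J x + t ^+ 2 * \sum_(l < J) (w l)^-1 * christoffel l x =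
    \sum_(l < J) \sum_(k < Z l) w l * (b l k + t * (w l)^-1 * Y k x) ^+ 2.
  rewrite /combination !mulr_sumr -!big_split; apply: eq_bigr => l _ /=.
  rewrite /christoffel !mulr_sumr -!big_split; apply: eq_bigr => k _ /=.
  by field; rewrite gt_eqF.
by do 2 (apply: sumr_ge0 => ? _); rewrite mulr_ge0 ?sqr_ge0 // ltW.
Qed.

End HarmonicBasis.

(** * Rotations and transitivity on the sphere *)

Section Rotations.
Context (R : realType) (d : nat).
Local Notation V := 'rV[R]_d.+1.
Local Notation S := (sphere R d).
Implicit Types (x y z v w : V) (O : 'M[R]_d.+1).

Definition rdot x y : R := (x *m y^T) 0 0.

Lemma rdotE x y : rdot x y = \sum_i x 0 i * y 0 i.
Proof. by rewrite /rdot mxE; apply: eq_bigr => i _; rewrite mxE. Qed.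

Lemma rdotC x y : rdot x y = rdot y x.
Proof. by rewrite !rdotE; apply: eq_bigr => i _; rewrite mulrC. Qed.

Lemma rdotDl x y z : rdot (x + y) z = rdot x z + rdot y z.
Proof. by rewrite /rdot mulmxDl mxE. Qed.

Lemma rdotZl (c : R) x y : rdot (c *: x) y = c * rdot x y.
Proof. by rewrite /rdot -scalemxAl mxE. Qed.

Lemma enormE x : enorm x = Num.sqrt (rdot x x).
Proof. by rewrite rdotE /enorm; congr Num.sqrt; apply: eq_bigr => i _; rewrite expr2. Qed.

Lemma rdot_ge0 x : 0 <= rdot x x.
Proof. by rewrite rdotE; apply: sumr_ge0 => i _; rewrite -expr2 sqr_ge0. Qed.

Lemma sphereP x : S x <-> rdot x x = 1.
Proof.
rewrite /sphere /= enormE; split=> [h|->]; last by rewrite sqrtr1.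
by rewrite -(sqr_sqrtr (rdot_ge0 x)) h expr1n.
Qed.

Lemma enorm_orthogonal O x : O *m O^T = 1%:M -> enorm (x *m O) = enorm x.
Proof. by move=> hO; rewrite !enormE /rdot trmx_mul mulmxA -(mulmxA x) hO mulmx1. Qed.

Definition reflection v : 'M[R]_d.+1 := 1%:M - 2 *: (v^T *m v).

Lemma mul_reflection x v : x *m reflection v = x - (2 * rdot x v) *: v.
Proof.
rewrite /reflection mulmxBr mulmx1 -scalemxAr mulmxA.
have -> : x *m v^T = (rdot x v)%:M.
  exact: mx11_scalar.
by rewrite mul_scalar_mx scalerA.
Qed.

Lemma reflection_tr v : (reflection v)^T = reflection v.
Proof. by rewrite /reflection linearB /= trmx1 linearZ /= trmx_mul trmxK. Qed.

Lemma reflection_orthogonal v : S v -> reflection v *m (reflection v)^T = 1%:M.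
Proof.
move=> /sphereP v1; rewrite reflection_tr /reflection.
set P := v^T *m v.
have PP : P *m P = P.
  rewrite /P mulmxA -(mulmxA _ v) [v *m v^T]mx11_scalar -/(rdot v v) v1.
  by rewrite mulmx1.
rewrite mulmxBl mul1mx mulmxBr mulmx1 -scalemxAr -scalemxAl scalerA PP.
by apply/matrixP => i j; rewrite !mxE; ring.
Qed.

(** Two triangular factorizations of the same block matrix, eliminating one or the other corner. *)
Lemma det_1subM (n : nat) (u : 'cV[R]_n) (v : 'rV[R]_n) :
  \det (1%:M - u *m v) = 1 - (v *m u) 0 0.
Proof.
have E1 : block_mx (1%:M : 'M[R]_1) v u 1%:M =
    block_mx 1%:M 0 u 1%:M *m block_mx 1%:M v 0 (1%:M - u *m v).
  by rewrite mulmx_block !(mul1mx, mul0mx, mulmx0, mulmx1, addr0) [u *m v + _]addrC subrK.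
have E2 : block_mx (1%:M : 'M[R]_1) v u 1%:M =
    block_mx (1%:M - v *m u) v 0 1%:M *m block_mx 1%:M 0 u 1%:M.
  by rewrite mulmx_block !(mul1mx, mul0mx, mulmx0, mulmx1, add0r) subrK.
have := congr1 determinant E1; rewrite E2 !det_mulmx !det_lblock !det_ublock !det1.
by rewrite !mul1r !mulr1 det_mx11 !mxE eqxx mulr1n => ->.
Qed.

Lemma det_reflection v : S v -> \det (reflection v) = -1.
Proof.
move=> /sphereP v1; rewrite /reflection scalemxAl det_1subM -scalemxAr mxE.
by rewrite -/(rdot v v) v1 mulr1; ring.
Qed.

(** The reflection along y sends y to -y, and the one along y + z sends -y to z; two reflections
    have determinant 1. *)
Lemma sphere_rotation y z : S y -> S z -> y + z != 0 ->
  exists O : 'M[R]_d.+1, [/\ O *m O^T = 1%:M, \det O = 1 & y *m O = z].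
Proof.
move=> Sy Sz yz0.
have y1 := (sphereP y).1 Sy; have z1 := (sphereP z).1 Sz.
pose q := rdot (y + z) (y + z).
have q0 : 0 < q.
  rewrite lt_neqAle rdot_ge0 andbT eq_sym; apply: contra_neq yz0 => q0.
  apply/rowP => i; rewrite mxE [RHS]mxE; move: q0; rewrite /q rdotE => /eqP.
  rewrite psumr_eq0 => [/allP/(_ i)|j _]; last by rewrite -expr2 sqr_ge0.
  by rewrite mem_index_enum => /(_ isT) /=; rewrite mulf_eq0 orbb mxE => /eqP.
have qE : q = 2 * (1 + rdot y z).
  by rewrite /q rdotDl !(rdotC _ (y + z)) !rdotDl y1 z1 (rdotC z y); ring.
pose w := (Num.sqrt q)^-1 *: (y + z).
have Sw : S w.
  apply/sphereP; rewrite /w rdotZl rdotC rdotZl -/q mulrA -invfM -expr2 sqr_sqrtr ?ltW //.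
  by rewrite mulVf // gt_eqF.
exists (reflection y *m reflection w); split.
- rewrite trmx_mul mulmxA -(mulmxA (reflection y)) reflection_orthogonal //.
  by rewrite mulmx1 reflection_orthogonal.
- by rewrite det_mulmx !det_reflection // mulrNN mulr1.
rewrite mulmxA (mul_reflection y) y1 mulr1 mul_reflection.
have -> : y - 2 *: y = -1 *: y by rewrite scaler_nat mulr2n opprD addrA subrr sub0r scaleN1r.
have -> : rdot (-1 *: y) w = - ((Num.sqrt q)^-1 * (1 + rdot y z)).
  by rewrite rdotZl rdotC rdotZl rdotDl y1 (rdotC z) mulN1r.
rewrite /w scalerA.
have -> : 2 * - ((Num.sqrt q)^-1 * (1 + rdot y z)) / Num.sqrt q = -1.
  have -> : 2 * - ((Num.sqrt q)^-1 * (1 + rdot y z)) / Num.sqrt q =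
    - (2 * (1 + rdot y z)) / Num.sqrt q ^+ 2.
    by rewrite expr2 invfM; ring.
  by rewrite -qE sqr_sqrtr ?ltW // mulNr mulfV // gt_eqF.
by rewrite !scaleN1r opprK addrA addNr add0r.
Qed.

(** Antipodal points escape [sphere_rotation] and are joined through a coordinate vector opposite to
    neither, which exists because d > 0. *)
Lemma sphere_eq_of_rotation (T : Type) (F : V -> T) : (0 < d)%N ->
  (forall (O : 'M[R]_d.+1) y, O *m O^T = 1%:M -> \det O = 1 -> S y -> F (y *m O) = F y) ->
  forall y z, S y -> S z -> F y = F z.
Proof.
move=> d0 FO.
have F1 y z : S y -> S z -> y + z != 0 -> F y = F z.
  by move=> Sy Sz /(sphere_rotation Sy Sz)[A [A1 A2 <-]]; rewrite FO.
move=> y z Sy Sz; have [yz|] := eqVneq (y + z) 0; last exact: F1.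
have zE : z = - y by apply/eqP; rewrite -addr_eq0 addrC yz.
have Se i : S (delta_mx 0 i).
  by apply/sphereP; rewrite /rdot trmx_delta mul_delta_mx mxE !eqxx.
have [i [iy iz]] : exists i, y + delta_mx 0 i != 0 /\ delta_mx 0 i + z != 0.
  have e01 : (ord0 : 'I_d.+1) != ord_max by rewrite -(inj_eq val_inj) /= neq_ltn d0.
  (* If the first coordinate vector is opposite to y or z, then y has last coordinate 0 and the last
     coordinate vector is suitable. *)
  have [E|E] := boolP ((y + delta_mx 0 ord0 == 0) || (delta_mx 0 ord0 + z == 0)); last first.
    by exists ord0; move: E; rewrite negb_or => /andP.
  have y0 : y 0 ord_max = 0.
    case/orP: E => /eqP /rowP /(_ ord_max); rewrite ?zE !mxE eqxx /= eq_sym (negPf e01).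
      by rewrite addr0.
    by rewrite add0r => /eqP; rewrite oppr_eq0 => /eqP.
  exists ord_max; split; apply/eqP => /rowP /(_ ord_max); rewrite ?zE !mxE !eqxx y0 /=.
    by rewrite add0r => /eqP; rewrite oner_eq0.
  by rewrite subr0 => /eqP; rewrite oner_eq0.
by rewrite (F1 _ _ Sy (Se i) iy) (F1 _ _ (Se i) Sz iz).
Qed.

End Rotations.

(** * Zonal kernels *)

Section ZonalKernel.
Context (R : realType) (d : nat) (mu : probability (borel_rV R d.+1) R).
Hypothesis hmu : uniform_on_sphere mu.
Context (phi : R -> R) (rho : R).
Hypothesis hphi : continuous_on_0_infty phi.
Hypothesis rho0 : 0 < rho.
Local Notation V := 'rV[R]_d.+1.
Local Notation S := (sphere R d).
Local Notation I := (sphere_integral mu).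

Lemma mulmxr_continuous (A : 'M[R]_d.+1) : continuous (fun x : V => x *m A).
Proof.
have cA j : continuous (fun x : V => (x *m A) 0 j).
  under eq_fun do rewrite mxE.
  apply: continuous_big_sum => i x.
  exact: cvgM (@coord_continuous _ _ _ 0 i x) (cvg_cst _).
move=> x B [Q xQ QB].
have xF : Filter (nbhs (x : V)) by typeclasses eauto.
have : \forall u \near x, forall j, Q 0 j ((u *m A) 0 j).
  apply: (@filter_forall _ _ _ _ xF) => j; exact: cA (xQ 0 j).
by apply: (@filterS _ _ xF) => u uQ; apply: QB => i j; rewrite (ord1 i).
Qed.

Lemma measurable_mulmxr (A : 'M[R]_d.+1) :
  measurable_fun setT ((fun x : V => x *m A) : borel_rV R d.+1 -> borel_rV R d.+1).
Proof.
apply: (measurability (@open V : set (set (borel_rV R d.+1))) erefl) => _ [U oU <-].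
rewrite setTI; apply: sub_sigma_algebra; apply: open_comp => // x _.
exact: mulmxr_continuous.
Qed.

Lemma sphere_integral_rotation (A : 'M[R]_d.+1) (f : V -> R) :
  A *m A^T = 1%:M -> \det A = 1 -> continuous f ->
  I (fun x => f (x *m A)) = I f.
Proof.
move=> A1 A2 ctf; have cf : sphere_continuous f by exact: continuous_subspaceT.
have [_ inv] := hmu.
pose rA := (fun x : V => x *m A) : borel_rV R d.+1 -> borel_rV R d.+1.
have mrA : measurable_fun setT rA by exact: measurable_mulmxr.
have SA x : S (x *m A) = S x by rewrite /sphere /= enorm_orthogonal.
have mS := @measurable_sphere R d.
pose g : borel_rV R d.+1 -> \bar R := (EFin \o f) \_ S.
have mg : measurable_fun setT g.
  apply/(measurable_restrictT _ _).1 => //.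
  by apply/measurable_EFinP; exact: sphere_continuous_measurable.
have gA : g \o rA = (EFin \o (fun x => f (x *m A))) \_ S.
  apply/funext => x; rewrite /g /= !patchE /rA.
  by have -> : (x *m A \in S) = (x \in S) by apply/idP/idP; rewrite !inE SA.
rewrite /sphere_integral /Rintegral; congr fine.
rewrite [LHS]integral_mkcond [RHS]integral_mkcond.
transitivity (\int[mu]_x (g \o rA) x)%E; first by rewrite gA.
transitivity (\int[pushforward mu rA]_x g x)%E; last first.
  by apply: eq_measure_integral => B mB _; exact: inv.
have cfA : sphere_continuous (fun x => f (x *m A)).
  apply: continuous_subspaceT => x.
  apply: (@continuous_comp _ _ _ (fun x : V => x *m A) f); last exact: ctf.
  exact: mulmxr_continuous.
rewrite integral_pushforward ?preimage_setT ?gA //.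
exact: ((integrable_mkcond _ mS).1 (sphere_integrable mu cfA)).
Qed.

Lemma Phi_continuous y : continuous (fun x : V => Phi phi rho (x - y)).
Proof.
move=> x; rewrite /Phi.
have [cphi _] := hphi.
pose g (x : V) := rho^-1 * enorm (x - y).
have ce : continuous (fun u : V => \sum_i ((u - y) ord0 i) ^+ 2).
  apply: continuous_big_sum => i u.
  under eq_fun do rewrite !mxE.
  have cd : (fun u : V => u ord0 i - y ord0 i) @ u --> u ord0 i - y ord0 i.
    exact: cvgB (@coord_continuous _ _ _ ord0 i u) (cvg_cst _).
  by apply: (cvgM cd cd).
have cn : continuous (fun u : V => enorm (u - y)).
  move=> u; apply: (@continuous_comp _ _ _ (fun u : V => \sum_i ((u - y) ord0 i) ^+ 2)
    (@Num.sqrt R)); [exact: ce|exact: sqrt_continuous].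
have cg : continuous g by move=> u; exact: cvgM (cvg_cst _) (cn u).
have g0 u : `[0, +oo[%classic (g u).
  by rewrite /= in_itv /= andbT mulr_ge0 ?invr_ge0 ?(ltW rho0) // sqrtr_ge0.
move=> B wB; have := cphi (g x) B wB.
(* [phi] is continuous only relative to the closed half-line, which the scaled distance never
   leaves. *)
rewrite -[X in X -> _]/(nbhs_subspace (g x) (phi @^-1` B)) -nbhs_subspace_in; last exact: g0.
move=> hB; have := cg x _ hB.
have xF : Filter (nbhs (x : V)) by typeclasses eauto.
by apply: (@filterS _ _ xF) => u; apply; exact: g0.
Qed.

Lemma Lambda_eq : (0 < d)%N -> forall y z, S y -> S z ->
  Lambda mu phi rho y = Lambda mu phi rho z.
Proof.
move=> d0; apply: sphere_eq_of_rotation => // A y A1 A2 Sy.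
rewrite /Lambda -/(sphere_integral _ _) -(sphere_integral_rotation A1 A2).
  by apply: eq_sphere_integral => x _; rewrite /Phi -mulmxBl enorm_orthogonal.
exact: Phi_continuous.
Qed.

Lemma zonal_kernel_continuous y : sphere_continuous (zonal_kernel mu phi rho ^~ y).
Proof.
by apply: sphere_continuousZ; apply: continuous_subspaceT; exact: Phi_continuous.
Qed.

(** The diagonal value is phi 0 divided by the normalization, and the latter is rotation
    invariant. *)
Lemma zonal_kernel_diag : (0 < d)%N -> forall x y, S x -> S y ->
  zonal_kernel mu phi rho x x = zonal_kernel mu phi rho y y.
Proof.
by move=> d0 x y Sx Sy; rewrite /zonal_kernel (Lambda_eq d0 Sx Sy) !subrr.
Qed.

End ZonalKernel.

(** * Sobolev weights and norms *)

Section SobolevWeights.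
Context (R : realType) (d : nat) (mu : probability (borel_rV R d.+1) R).
Context (Z : nat -> nat) (Y : forall l : nat, 'I_(Z l) -> 'rV[R]_d.+1 -> R).
Context (sigma : R).
Hypothesis sigma0 : 0 < sigma.

Definition sobolev_weight (l : nat) : R := (1 + l%:R) `^ (2 * sigma).

Lemma sobolev_weight_gt0 l : 0 < sobolev_weight l.
Proof. by rewrite powR_gt0 // ltr_pwDl. Qed.

Lemma increment_sobolev_weight_ge0 l : 0 <= increment sobolev_weight l.
Proof.
rewrite /increment; case: l => [|l]; first by rewrite subr0 ltW // sobolev_weight_gt0.
rewrite subr_ge0 ge0_ler_powR ?nnegrE ?addr_ge0 ?mulr_ge0 ?(ltW sigma0) //.
by rewrite lerD2l ler_nat.
Qed.

Lemma sobolev_weight_double l : sobolev_weight l.*2 <= 2 `^ (2 * sigma) * sobolev_weight l.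
Proof.
rewrite /sobolev_weight -powRM ?addr_ge0 //.
rewrite ge0_ler_powR ?nnegrE ?mulr_ge0 ?addr_ge0 ?(ltW sigma0) //.
by rewrite mulrDr mulr1 -mul2n natrM lerD2r; lra.
Qed.

Lemma sobolev_sqnormE f :
  sobolev_sqnorm mu Y sigma f =
  (\sum_(0 <= l <oo) (sobolev_weight l * degree_energy mu Y f l)%:E)%E.
Proof.
rewrite /sobolev_sqnorm; congr (limn _); apply/funext => L; apply: eq_bigr => l _.
rewrite /degree_energy mulr_sumr; congr (_%:E); apply: eq_bigr => k _.
by rewrite real_normK ?num_real.
Qed.

Let term_ge0 f l : 0 <= sobolev_weight l * degree_energy mu Y f l.
Proof. by rewrite mulr_ge0 ?degree_energy_ge0 // ltW // sobolev_weight_gt0. Qed.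

Lemma sobolev_sqnorm_le f (B : R) :
  (forall L, \sum_(l < L) sobolev_weight l * degree_energy mu Y f l <= B) ->
  (sobolev_sqnorm mu Y sigma f <= B%:E)%E.
Proof.
move=> h; rewrite sobolev_sqnormE; apply: lime_le.
  by apply: is_cvg_nneseries => l _ _; rewrite lee_fin.
by apply: nearW => L; rewrite sumEFin lee_fin big_mkord.
Qed.

Lemma sobolev_norm_le f (B : R) :
  (forall L, \sum_(l < L) sobolev_weight l * degree_energy mu Y f l <= B) ->
  sobolev_norm mu Y sigma f <= Num.sqrt B.
Proof.
move=> h; have B0 : 0 <= B by have := h 0%N; rewrite big_ord0.
rewrite /sobolev_norm ler_sqrt //.
have hB := sobolev_sqnorm_le h.
have h0 : (0 <= sobolev_sqnorm mu Y sigma f)%E.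
  by rewrite sobolev_sqnormE; apply: nneseries_ge0 => l _ _; rewrite lee_fin.
rewrite -lee_fin fineK // ge0_fin_numE //; exact: le_lt_trans hB (ltry _).
Qed.

Lemma sum_sobolev_le f L : (sobolev_sqnorm mu Y sigma f < +oo)%E ->
  \sum_(l < L) sobolev_weight l * degree_energy mu Y f l <=
  sobolev_norm mu Y sigma f ^+ 2.
Proof.
move=> foo.
have h0 : (0 <= sobolev_sqnorm mu Y sigma f)%E.
  by rewrite sobolev_sqnormE; apply: nneseries_ge0 => l _ _; rewrite lee_fin.
rewrite /sobolev_norm sqr_sqrtr ?fine_ge0 //.
rewrite -lee_fin fineK ?ge0_fin_numE // sobolev_sqnormE.
apply: le_trans (nneseries_lim_ge L _); last by move=> l _ _; rewrite lee_fin.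
by rewrite sumEFin big_mkord.
Qed.

End SobolevWeights.

(** * Approximation *)

Section Approximation.
Context (R : realType) (d : nat) (hd : (0 < d)%N).
Context (mu : probability (borel_rV R d.+1) R) (hmu : uniform_on_sphere mu).
Context (Z : nat -> nat) (Y : forall l : nat, 'I_(Z l) -> 'rV[R]_d.+1 -> R).
Hypothesis hY : spherical_harmonic_basis mu Y.
Context (sigma m s rho0 : R).
Hypotheses (hm : d%:R / 2 < m) (hsigma : m <= sigma) (hs : sigma <= s)
  (hrho0 : 0 < rho0 < 1).
Context (phi : R -> R) (hphi : continuous_on_0_infty phi).
Context (phihat : R -> nat -> R).
Hypothesis hphihat : forall rho : R, 0 < rho < rho0 ->
  fourier_legendre Y (zonal_kernel mu phi rho) (phihat rho).
Context (c1 c2 c3 c4 : R).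
Hypotheses (hc1 : 0 < c1) (hc2 : 0 < c2) (hc3 : 0 < c3) (hc34 : c3 <= c4).
Hypothesis hi : forall rho : R, 0 < rho < rho0 ->
  forall l : nat, (l%:Z <= Num.floor (rho^-1 - 1)) ->
  `|1 - phihat rho l| <= c1 * l%:R `^ m * rho `^ m.
Hypothesis hii : forall rho : R, 0 < rho < rho0 ->
  forall l : nat, (Num.floor (rho^-1 - 1) < l%:Z) -> phihat rho l <= c2.
Hypothesis hiii : forall rho : R, 0 < rho < rho0 ->
  forall l : nat, (0 < l)%N ->
  c3 * (1 + rho * l%:R) `^ (- (2 * s)) <= phihat rho l
  <= c4 * (1 + rho * l%:R) `^ (- (2 * s)).
Local Notation V := 'rV[R]_d.+1.
Local Notation S := (sphere R d).
Local Notation I := (sphere_integral mu).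
Local Notation K rho := (zonal_kernel mu phi rho).
Local Notation w := (sobolev_weight sigma).

Let d0 : 0 < d%:R :> R. Proof. by rewrite ltr0n. Qed.
Let m0 : 0 < m. Proof. by move: d0 hm; lra. Qed.
Let s2d : d%:R < 2 * s. Proof. by move: hm hsigma hs; lra. Qed.
Let sigma2d : d%:R < 2 * sigma. Proof. by move: hm hsigma; lra. Qed.
Let sigma0 : 0 < sigma. Proof. exact: lt_le_trans m0 hsigma. Qed.
Let mu1 : mu S = 1%E. Proof. by case: hmu. Qed.
Let rho_lt1 rho : 0 < rho < rho0 -> rho < 1.
Proof. by move: hrho0 => /andP[_ h] /andP[_ h']; exact: lt_trans h' h. Qed.

(** Condition (iii) omits l = 0, where (i) forces the value 1 since m > 0. Bounds for all l
    therefore use 1 + c4 and min 1 c3. *)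
Lemma phihat0 rho : 0 < rho < rho0 -> phihat rho 0 = 1.
Proof.
move=> hr; have /andP[r0 _] := hr.
have := @hi rho hr 0%N; rewrite powR0 ?gt_eqF // mulr0 mul0r normr_le0 subr_eq0.
move=> h; apply/esym/eqP/h; rewrite floor_ge0 subr_ge0 invf_ge1 //.
by rewrite ltW // rho_lt1.
Qed.

Lemma phihat_le rho l : 0 < rho < rho0 ->
  phihat rho l <= (1 + c4) * (1 + rho * l%:R) `^ (- (2 * s)).
Proof.
move=> hr; have /andP[r0 _] := hr.
case: l => [|l]; first by rewrite phihat0 // mulr0 addr0 powR1 mulr1; move: hc3 hc34; lra.
have /andP[_ h] := hiii hr (ltn0Sn l); apply: le_trans h _.
by rewrite ler_wpM2r ?powR_ge0 // lerDr.
Qed.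

Lemma phihat_ge rho l : 0 < rho < rho0 ->
  Num.min 1 c3 * (1 + rho * l%:R) `^ (- (2 * s)) <= phihat rho l.
Proof.
move=> hr; case: l => [|l].
  by rewrite phihat0 // mulr0 addr0 powR1 mulr1 ge_min lexx.
have /andP[h _] := hiii hr (ltn0Sn l); apply: le_trans h.
by rewrite ler_wpM2r ?powR_ge0 // ge_min lexx orbT.
Qed.

Let c3' : 0 < Num.min 1 c3. Proof. by rewrite lt_min ltr01. Qed.

Lemma phihat_ge0 rho l : 0 < rho < rho0 -> 0 <= phihat rho l.
Proof.
by move=> hr; apply: le_trans (phihat_ge l hr); rewrite mulr_ge0 ?powR_ge0 // ltW.
Qed.

Lemma one_le_1Drho rho l : 0 < rho -> 1 <= 1 + rho * l%:R :> R.
Proof. by move=> r0; rewrite lerDl mulr_ge0 // ltW. Qed.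

Lemma phihat_le_cst rho l : 0 < rho < rho0 -> phihat rho l <= 1 + c4.
Proof.
move=> hr; have /andP[r0 _] := hr; apply: le_trans (phihat_le l hr) _.
rewrite ler_piMr //; first by move: hc3 hc34; lra.
by rewrite powRN_le1 ?one_le_1Drho //; move: s2d d0; lra.
Qed.

Lemma zonal_kernel_diag_le : exists2 B : R, 0 < B &
  forall rho y, 0 < rho < rho0 -> S y -> K rho y y <= B * rho^-1 ^+ d.
Proof.
(* The constant comes from 2 (n + 1)^d <= 2 * 2^d n^d for n >= 1. *)
have [B B0 hB] := sum_weight_le (ler0n R (2 * 2 ^ d)) s2d.
have c40 : 0 < 1 + c4 by move: hc3 hc34; lra.
exists ((1 + c4) * B); first exact: mulr_gt0.
move=> rho y hr Sy; have /andP[r0 _] := hr.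
apply: (@kappa_le _ _ _ mu1 _ _ hY (K rho) (phihat rho)) => //.
- by move=> x Sx; apply: zonal_kernel_diag.
- exact: hphihat.
- by move=> l; exact: phihat_ge0.
move=> L; rewrite -mulrA.
apply: (@le_trans _ _ ((1 + c4) * \sum_(l < L) (1 + rho * l%:R) `^ (- (2 * s)) * (Z l)%:R)).
  rewrite mulr_sumr; apply: ler_sum => l _; rewrite mulrA ler_wpM2r //.
  exact: phihat_le.
rewrite ler_wpM2l ?(ltW c40) //; apply: (hB rho (fun l => (Z l)%:R)) => [|l|n n0].
- by rewrite r0 ltW // rho_lt1.
- by [].
rewrite -natr_sum -natrX -natrM ler_nat.
apply: leq_trans (sum_dim_le mu1 hY n) _.
rewrite -mulnA leq_mul2l /= -expnMn; case: (d) => // e.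
by rewrite leq_exp2r // mul2n -addnn -addn1 leq_add2l.
Qed.

(** For rho of order 1/L the coefficients of degree below L are bounded below, so the diagonal bound
    O(rho^-d) makes the first L Christoffel sums O(L^d) at every point. [sum_weight_le] at scale 1
    concludes, as 2 sigma > d. *)
Lemma sum_christoffel_weight_le : exists2 B : R, 0 < B &
  forall x n, S x -> \sum_(l < n) (w l)^-1 * christoffel Y l x <= B.
Proof.
have [Bk Bk0 hBk] := zonal_kernel_diag_le.
have /andP[rho00 rho01] := hrho0.
pose Cc := Bk * (2 / rho0) ^+ d / (Num.min 1 c3 * 2 `^ (- (2 * s))).
have Cc0 : 0 <= Cc.
  by rewrite /Cc !mulr_ge0 ?exprn_ge0 ?invr_ge0 ?mulr_ge0 ?powR_ge0 ?invr_ge0 ?ltW.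
have [B B0 hB] := sum_weight_le Cc0 sigma2d.
exists B => // x n Sx.
have -> : \sum_(l < n) (w l)^-1 * christoffel Y l x =
    \sum_(l < n) (1 + 1 * l%:R) `^ (- (2 * sigma)) * christoffel Y l x.
  by apply: eq_bigr => l _; rewrite mul1r powRN.
rewrite (_ : B = B * 1^-1 ^+ d); last by rewrite invr1 expr1n mulr1.
apply: (hB 1 (fun l => christoffel Y l x)) => [|l|L L0].
- by rewrite ltr01 lexx.
- exact: christoffel_ge0.
have LR : 0 < L%:R :> R by rewrite ltr0n.
(* This gives rho l <= 1 for l < L, and rho < rho0 even when L = 1. *)
pose rho := rho0 / 2 / L%:R.
have r0 : 0 < rho by rewrite !divr_gt0.
have L1 : 1 <= L%:R :> R by rewrite (ler_nat R 1).
have hr : 0 < rho < rho0.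
  by rewrite r0 /rho ltr_pdivrMr //; move: L1 rho00; nra.
have h1 : \sum_(l < L) phihat rho l * christoffel Y l x <= Bk * rho^-1 ^+ d.
  apply: le_trans (hBk rho x hr Sx).
  apply: (@sum_christoffel_le _ _ _ _ (K rho) (phihat rho)) => //.
  - by move=> u Su; apply: zonal_kernel_diag.
  - exact: hphihat.
  - by move=> l; exact: phihat_ge0.
have p0 : 0 < Num.min 1 c3 * 2 `^ (- (2 * s)) by rewrite mulr_gt0 // powR_gt0.
rewrite /Cc mulrAC ler_pdivlMr // -mulrA -exprMn.
have -> : 2 / rho0 * L%:R = rho^-1 by rewrite /rho !invfM !invrK; ring.
apply: le_trans h1; rewrite mulr_suml; apply: ler_sum => l _.
rewrite mulrC ler_wpM2r ?christoffel_ge0 //.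
apply: le_trans (phihat_ge l hr); rewrite ler_wpM2l ?(ltW c3') //.
rewrite ler_powRN //; first by rewrite ltr_pwDl // mulr_ge0 // ltW.
  rewrite -[leRHS]/(1 + 1) lerD2l /rho mulrAC ler_pdivrMr // mul1r.
  have lL : (l : nat)%:R <= L%:R :> R by rewrite ler_nat ltnW.
  have l0 : 0 <= (l : nat)%:R :> R by [].
  nra.
by move: s2d d0; lra.
Qed.

(** * The noiseless error *)

Context (f : V -> R) (hf : in_sobolev mu Y sigma f).
Context (n : nat -> nat) (x : forall k : nat, 'I_(n k) -> V).
Hypothesis hx : QMC_design mu Y sigma x.
Local Notation fnorm := (sobolev_norm mu Y sigma f).

Definition quadrature_error k (g : V -> R) : R :=
  (n k)%:R^-1 * \sum_(j < n k) g (x j) - I g.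

Lemma quadrature_errorZ k c g : sphere_continuous g ->
  quadrature_error k (fun y => c * g y) = c * quadrature_error k g.
Proof.
by move=> cg; rewrite /quadrature_error sphere_integralZ // -mulr_sumr; ring.
Qed.

Lemma quadrature_error_sum k (J : Type) (r : seq J) (F : J -> V -> R) :
  (forall i, sphere_continuous (F i)) ->
  quadrature_error k (fun y => \sum_(i <- r) F i y) =
  \sum_(i <- r) quadrature_error k (F i).
Proof.
move=> cF; rewrite /quadrature_error sphere_integral_sum // exchange_big /=.
by rewrite mulr_sumr -sumrB.
Qed.

Let cf : sphere_continuous f. Proof. by case: hf. Qed.
Let cY l (k : 'I_(Z l)) : sphere_continuous (Y k). Proof. exact: (basis_continuous hY). Qed.

(** The cut at degree L makes the dual function a finite combination; all bounds on it are uniform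
    in L. *)
Definition filtered_error rho k L : R :=
  \sum_(l < L) \sum_(j < Z l)
    phihat rho l ^+ 2 * quadrature_error k (fun y => f y * Y j y) ^+ 2.

(** Since 1 + l <= rho^-1 (1 + rho l), the weight is at most rho^(-2 sigma) (1 + rho l)^(2 sigma),
    and the decay (1 + rho l)^(-4 s) of the squared coefficient absorbs the second factor. *)
Lemma weight_phihat_le rho l : 0 < rho < rho0 ->
  w l * phihat rho l ^+ 2 <= (1 + c4) ^+ 2 * (rho `^ (- sigma)) ^+ 2.
Proof.
move=> hr; have /andP[r0 _] := hr.
have c40 : 0 < 1 + c4 by move: hc3 hc34; lra.
have g0 := one_le_1Drho l r0.
have wle : w l <= (rho `^ (- sigma)) ^+ 2 * (1 + rho * l%:R) `^ (2 * sigma).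
  have -> : (rho `^ (- sigma)) ^+ 2 = rho^-1 `^ (2 * sigma).
    rewrite -[in RHS](powR_inv1 (ltW r0)) -powRrM -powR_mulrn ?powR_ge0 // -powRrM.
    by congr (_ `^ _); ring.
  rewrite -powRM ?invr_ge0 ?(ltW r0) ?(le_trans _ g0) //.
  rewrite ge0_ler_powR ?nnegrE ?mulr_ge0 ?addr_ge0 ?invr_ge0 ?mulr_ge0 ?(ltW r0) ?(ltW sigma0) //.
  rewrite mulrDr mulr1 mulKf ?gt_eqF // lerD2r invf_ge1 // ltW // rho_lt1 //.
have p2 : phihat rho l ^+ 2 <= (1 + c4) ^+ 2 * (1 + rho * l%:R) `^ (- (2 * sigma)).
  apply: (@le_trans _ _ (((1 + c4) * (1 + rho * l%:R) `^ (- (2 * s))) ^+ 2)).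
    by rewrite lerXn2r ?nnegrE ?phihat_ge0 ?phihat_le // mulr_ge0 ?powR_ge0 ?(ltW c40).
  rewrite exprMn ler_wpM2l ?exprn_ge0 ?(ltW c40) //.
  rewrite -powR_mulrn ?powR_ge0 // -powRrM; apply: ler_powR => //.
  by move: hs sigma0; lra.
apply: le_trans (ler_pM (ltW (sobolev_weight_gt0 _ _)) (sqr_ge0 _) wle p2) _.
have gp : 0 < (1 + rho * l%:R) `^ (2 * sigma) by rewrite powR_gt0 // (lt_le_trans ltr01).
by rewrite mulrACA (powRN _ (2 * sigma)) mulfV ?gt_eqF // mulr1 mulrC.
Qed.

Lemma filtered_error_le : exists2 C : R, 0 < C & forall rho k L, 0 < rho < rho0 ->
  filtered_error rho k L <=
  C * (rho `^ (- sigma) * (n k)%:R `^ (- (sigma / d%:R))) ^+ 2.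
Proof.
have [U2 U20 hU2] := sum_christoffel_weight_le.
have [n0 _ xS [Cq Cq0 hq]] := hx.
have [F F0 fF] := sphere_continuous_bounded cf.
have foo : (sobolev_sqnorm mu Y sigma f < +oo)%E by case: hf.
pose A : R := 2 `^ (2 * sigma).
have A0 : 0 < A by rewrite powR_gt0.
pose A1 := 2 * A * (F ^+ 2 + U2 * fnorm ^+ 2).
have A10 : 0 <= A1.
  rewrite /A1 mulr_ge0 //; first by rewrite mulr_ge0 // ltW.
  by rewrite addr_ge0 ?sqr_ge0 // mulr_ge0 ?sqr_ge0 // ltW.
pose c4' := 1 + c4; have c40 : 0 < c4' by rewrite /c4'; move: hc3 hc34; lra.
have CA0 : 0 <= Cq ^+ 2 * A1 * c4' ^+ 2 := mulr_ge0 (mulr_ge0 (sqr_ge0 _) A10) (sqr_ge0 _).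
exists (Cq ^+ 2 * A1 * c4' ^+ 2 + 1); first by rewrite ltr_wpDl.
move=> rho k L hr; have /andP[r0 _] := hr.
pose e l (j : 'I_(Z l)) := quadrature_error k (fun y => f y * Y j y).
(* Coefficients of the dual function, chosen so that the quadrature error of f u is E itself. *)
pose b l (j : 'I_(Z l)) : R := if (l < L)%N then phihat rho l ^+ 2 * e l j else 0.
set E := filtered_error rho k L.
have E0 : 0 <= E.
  by do 2 (apply: sumr_ge0 => ? _); rewrite mulr_ge0 ?sqr_ge0.
pose u := combination Y b L.
have cu : sphere_continuous u by exact: (combination_continuous hY).
(* [weighted_energy_productM] wants a cut-off above the degrees being summed; raising it past L
   leaves u unchanged. *)
have uM M y : (L <= M)%N -> combination Y b M y = u y.
  move=> LM; rewrite /u /combination.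
  rewrite -(big_mkord xpredT (fun l => \sum_(j < Z l) b l j * Y j y)).
  rewrite (big_cat_nat (n := L)) //= big_mkord [X in _ + X]big_nat_cond [X in _ + X]big1 ?addr0 //.
  move=> l /andP[/andP[Ll _] _]; apply: big1 => j _.
  by rewrite /b ltnNge Ll mul0r.
have cfY l (j : 'I_(Z l)) : sphere_continuous (fun y => f y * Y j y).
  exact: sphere_continuousM.
have cfu : sphere_continuous (fun y => f y * u y) by exact: sphere_continuousM.
have errE : quadrature_error k (fun y => f y * u y) = E.
  have -> : (fun y => f y * u y) =
      (fun y => \sum_(l < L) \sum_(j < Z l) b l j * (f y * Y j y)).
    apply/funext => y; rewrite /u /combination mulr_sumr; apply: eq_bigr => l _.
    by rewrite mulr_sumr; apply: eq_bigr => j _; rewrite mulrCA.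
  rewrite quadrature_error_sum => [|l]; last first.
    by apply: sphere_continuous_sum => j; exact: sphere_continuousZ.
  apply: eq_bigr => l _; rewrite quadrature_error_sum => [|j]; last exact: sphere_continuousZ.
  apply: eq_bigr => j _; rewrite quadrature_errorZ // /b ltn_ord /e.
  by rewrite -mulrA -expr2.
pose W M := \sum_(l < M) w l * \sum_(j < Z l) b l j ^+ 2.
pose WB := c4' ^+ 2 * (rho `^ (- sigma)) ^+ 2 * E.
have WB0 : 0 <= WB := mulr_ge0 (mulr_ge0 (sqr_ge0 _) (sqr_ge0 _)) E0.
have W0 l : 0 <= w l * \sum_(j < Z l) b l j ^+ 2.
  by rewrite mulr_ge0 ?(ltW (sobolev_weight_gt0 _ _)) // sumr_ge0 // => j _; exact: sqr_ge0.
(* Of the factor phihat^4 in the squared coefficient, one phihat^2 is spent against the weight and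
   the other rebuilds E. *)
have WL : W L <= WB.
  rewrite /WB /E /filtered_error mulr_sumr; apply: ler_sum => l _.
  rewrite !mulr_sumr; apply: ler_sum => j _; rewrite /b ltn_ord exprMn.
  rewrite -/(e l j) [w l * _]mulrCA.
  have := ler_wpM2r (mulr_ge0 (sqr_ge0 (phihat rho l)) (sqr_ge0 (e l j))) (weight_phihat_le l hr).
  by rewrite /c4' -!exprM /= => h; apply: le_trans h; rewrite le_eqVlt; apply/orP; left; apply/eqP; ring.
have WM M : W M <= WB.
  apply: le_trans WL.
  have [ML|LM] := leqP M L.
    rewrite /W -(big_mkord xpredT (fun l => w l * \sum_(j < Z l) b l j ^+ 2)).
    rewrite -[leRHS](big_mkord xpredT (fun l => w l * \sum_(j < Z l) b l j ^+ 2)).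
    by rewrite [leRHS](big_cat_nat (n := M)) //= lerDl sumr_ge0.
  rewrite /W -(big_mkord xpredT (fun l => w l * \sum_(j < Z l) b l j ^+ 2)).
  rewrite (big_cat_nat (n := L)) ?(ltnW LM) //= big_mkord [X in _ + X]big_nat_cond [X in _ + X]big1 ?addr0 //.
  move=> l /andP[/andP[Ll _] _]; rewrite big1 ?mulr0 // => j _.
  by rewrite /b ltnNge Ll /= expr0n.
pose U := Num.sqrt (WB * U2).
have bU J y : S y -> `|combination Y b J y| <= U.
  move=> Sy; rewrite -sqrtr_sqr ler_sqrt; last by rewrite mulr_ge0 // ltW.
  apply: le_trans (@combination_sqr_le _ _ _ Y b w J y (sobolev_weight_gt0 sigma)) _.
  apply: ler_pM; [|..|exact: WM|exact: hU2].
    exact: sumr_ge0.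
  apply: sumr_ge0 => l _; rewrite mulr_ge0 ?christoffel_ge0 // invr_ge0 ltW //.
  exact: sobolev_weight_gt0.
have fuB N : \sum_(l < N) w l * degree_energy mu Y (fun y => f y * u y) l <= A1 * WB.
  pose M := maxn N L.
  have -> : (fun y => f y * u y) = (fun y => f y * combination Y b M y).
    by apply/funext => y; rewrite uM // leq_maxr.
  have := @weighted_energy_productM _ _ _ mu1 _ _ hY f b w A (fnorm ^+ 2) F U N M
    cf fF bU (leq_maxl _ _) (increment_sobolev_weight_ge0 sigma0)
    (sobolev_weight_double sigma0) _ (ltW A0).
  move=> /(_ (fun L' => sum_sobolev_le L' foo)) h; apply: le_trans h _.
  rewrite /A1 -[leRHS]mulrA ler_wpM2l ?mulr_ge0 ?(ltW A0) // mulrDl lerD //.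
    by rewrite ler_wpM2l ?sqr_ge0 //; exact: WM.
  rewrite /U sqr_sqrtr; last by rewrite mulr_ge0 // ltW.
  by rewrite [WB * U2]mulrC mulrAC.
have sfu : in_sobolev mu Y sigma (fun y => f y * u y).
  split => //; first exact: sphere_continuous_in_L2.
  by apply: le_lt_trans (sobolev_sqnorm_le fuB) _; exact: ltry.
have := hq k _ sfu; rewrite -[X in `|X|]/(quadrature_error k (fun y => f y * u y)) errE.
rewrite ger0_norm // => EB.
have EB2 : E <= Cq * (n k)%:R `^ (- (sigma / d%:R)) * Num.sqrt (A1 * WB).
  apply: le_trans EB _; rewrite ler_wpM2l ?mulr_ge0 ?powR_ge0 ?(ltW Cq0) //.
  exact: sobolev_norm_le.
(* The right-hand side of [EB2] is of order E^(1/2); after squaring, one factor E cancels unless E =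
   0. *)
have EB3 : E ^+ 2 <= (Cq ^+ 2 * A1 * c4' ^+ 2 *
    (rho `^ (- sigma) * (n k)%:R `^ (- (sigma / d%:R))) ^+ 2) * E.
  apply: le_trans (_ : (Cq * (n k)%:R `^ (- (sigma / d%:R)) * Num.sqrt (A1 * WB)) ^+ 2 <= _).
    by rewrite lerXn2r ?nnegrE // (le_trans E0).
  rewrite !exprMn (sqr_sqrtr (mulr_ge0 A10 WB0)) /WB; move: (E) (A1) => e1 a1.
  by rewrite le_eqVlt; apply/orP; left; apply/eqP; ring.
have [->|En0] := eqVneq E 0.
  by rewrite mulr_ge0 ?sqr_ge0 // addr_ge0.
have Ep : 0 < E by rewrite lt_neqAle eq_sym En0.
move: EB3; rewrite expr2 ler_pM2r // => h; apply: le_trans h _.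
by rewrite ler_wpM2r ?sqr_ge0 // lerDl.
Qed.

(** Low degrees use (i). For high degrees rho (1 + l) > 1, so a bounded difference is already below
    a multiple of (rho (1 + l))^m. Finally m <= sigma allows the Sobolev weight. *)
Lemma phihat_bias_le rho l : 0 < rho < rho0 ->
  (phihat rho l - 1) ^+ 2 <= (c1 + 1 + c2) ^+ 2 * (rho `^ m) ^+ 2 * w l.
Proof.
move=> hr; have /andP[r0 _] := hr.
have cb0 : 0 < c1 + 1 + c2 by move: hc1 hc2; lra.
have l0 : 0 <= l%:R :> R by [].
have l10 : 0 <= 1 + l%:R :> R by rewrite addr_ge0.
have h : `|phihat rho l - 1| <= (c1 + 1 + c2) * (rho `^ m * (1 + l%:R) `^ m).
  rewrite distrC; have [hl|hl] := leP l%:Z (Num.floor (rho^-1 - 1)).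
    apply: le_trans (hi hr hl) _; rewrite -mulrA [l%:R `^ m * _]mulrC.
    apply: ler_pM; rewrite ?mulr_ge0 ?powR_ge0 ?(ltW hc1) //.
      by move: hc2; lra.
    rewrite ler_wpM2l ?powR_ge0 // ge0_ler_powR ?nnegrE ?(ltW m0) //.
    by rewrite lerDr.
  have p0 := phihat_ge0 l hr; have p2 := hii hr hl.
  have g1 : 1 <= rho `^ m * (1 + l%:R) `^ m.
    have e1 : 1 = 1 `^ m :> R by rewrite powR1.
    rewrite -powRM ?(ltW r0) // [leLHS]e1 ge0_ler_powR ?nnegrE ?(ltW m0) ?mulr_ge0 ?(ltW r0) //.
    move: hl; rewrite floor_lt_int ltrBlDr => hl.
    by rewrite mulrC -ler_pdivrMr // mul1r addrC ltW.
  have hb : `|1 - phihat rho l| <= c1 + 1 + c2.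
    by rewrite ler_norml; move: hc1 hc2; lra.
  by apply: le_trans hb _; rewrite ler_peMr // ltW.
rewrite -[leLHS]real_normK ?num_real //.
apply: (@le_trans _ _ (((c1 + 1 + c2) * (rho `^ m * (1 + l%:R) `^ m)) ^+ 2)).
  rewrite lerXn2r ?nnegrE //; apply: mulr_ge0; rewrite ?(ltW cb0) //.
  by rewrite mulr_ge0 ?powR_ge0.
rewrite !exprMn mulrA (ler_wpM2l (mulr_ge0 (sqr_ge0 _) (sqr_ge0 _))) //.
rewrite -powR_mulrn ?powR_ge0 // -powRrM /sobolev_weight ler_powR //.
  by rewrite lerDl.
by move: hsigma; lra.
Qed.

Definition quasi_error rho k (y : V) : R :=
  noisy_quasi_interpolant (K rho) (@x k) (fun=> 0) f y - f y.

Let xS k j : S (@x k j). Proof. by case: hx. Qed.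

Lemma quasi_error_continuous rho k : 0 < rho -> sphere_continuous (quasi_error rho k).
Proof.
move=> r0; apply: sphere_continuousB => //; apply: sphere_continuousZ.
apply: sphere_continuous_sum => j; apply: sphere_continuousZ.
exact: zonal_kernel_continuous.
Qed.

Lemma quasi_error_coef rho k l (i : 'I_(Z l)) : 0 < rho < rho0 ->
  fourier_coef mu Y (quasi_error rho k) i =
  phihat rho l * quadrature_error k (fun y => f y * Y i y) +
  (phihat rho l - 1) * fourier_coef mu Y f i.
Proof.
move=> hr; have /andP[r0 _] := hr.
have cK y : S y -> sphere_continuous ((K rho)^~ y).
  by move=> Sy; exact: zonal_kernel_continuous.
have [z Sz] : exists z, S z.
  by have [n0 _ _ _] := hx; exists (x (Ordinal (n0 k))).
have Kd y : S y -> K rho y y = K rho z z by move=> Sy; apply: zonal_kernel_diag.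
have cF j : sphere_continuous (fun y => (f (@x k j) + 0) * K rho y (x j)).
  by apply: sphere_continuousZ; exact: cK.
have -> : quasi_error rho k = (fun y =>
    (n k)%:R^-1 * (\sum_(j < n k) (f (x j) + 0) * K rho y (x j)) + (-1) * f y).
  by apply/funext => y; rewrite mulN1r.
rewrite (fourier_coefD hY); last first.
- exact: sphere_continuousZ.
- by apply: sphere_continuousZ; exact: sphere_continuous_sum.
rewrite !(fourier_coefZ hY) //; last exact: sphere_continuous_sum.
rewrite (fourier_coef_sum mu1 hY) //.
have -> : \sum_(j < n k) fourier_coef mu Y (fun y => (f (x j) + 0) * K rho y (x j)) i
    = phihat rho l * \sum_(j < n k) f (x j) * Y i (x j).
  rewrite mulr_sumr; apply: eq_bigr => j _; rewrite (fourier_coefZ hY); last exact: cK.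
  rewrite (fourier_coef_kernel mu1 hY cK Kd (hphihat hr) _ i (xS j)).
    by rewrite addr0 mulrCA.
  by move=> l'; exact: phihat_ge0.
rewrite /quadrature_error -[I _]/(fourier_coef mu Y f i); ring.
Qed.

Lemma quasi_error_energy_le rho k L : 0 < rho < rho0 ->
  \sum_(l < L) degree_energy mu Y (quasi_error rho k) l <=
  2 * filtered_error rho k L +
  2 * ((c1 + 1 + c2) ^+ 2 * (rho `^ m) ^+ 2 * fnorm ^+ 2).
Proof.
move=> hr; have foo : (sobolev_sqnorm mu Y sigma f < +oo)%E by case: hf.
have h : \sum_(l < L) (phihat rho l - 1) ^+ 2 * degree_energy mu Y f l <=
    (c1 + 1 + c2) ^+ 2 * (rho `^ m) ^+ 2 * fnorm ^+ 2.
  apply: le_trans (ler_wpM2l (mulr_ge0 (sqr_ge0 _) (sqr_ge0 _)) (sum_sobolev_le L foo)).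
  rewrite mulr_sumr; apply: ler_sum => l _; rewrite mulrA.
  by rewrite ler_wpM2r ?degree_energy_ge0 ?phihat_bias_le.
apply: le_trans (lerD (lexx _) (ler_wpM2l (ler0n R 2) h)).
rewrite /filtered_error !mulr_sumr -big_split /=; apply: ler_sum => l _.
rewrite /degree_energy !mulr_sumr -big_split /=; apply: ler_sum => i _.
rewrite quasi_error_coef //.
set a := _ * quadrature_error _ _; set b := _ * fourier_coef _ _ _ _.
have -> : phihat rho l ^+ 2 * quadrature_error k (fun y => f y * Y i y) ^+ 2 = a ^+ 2.
  by rewrite /a exprMn.
have -> : (phihat rho l - 1) ^+ 2 * fourier_coef mu Y f i ^+ 2 = b ^+ 2.
  by rewrite /b exprMn.
by have := sqr_ge0 (a - b); nra.
Qed.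

Lemma quasi_error_le : exists2 C : R, 0 < C & forall rho k, 0 < rho < rho0 ->
  I (fun y => quasi_error rho k y ^+ 2) <=
  C * (rho `^ (- sigma) * (n k)%:R `^ (- (sigma / d%:R))) ^+ 2 +
  C * (rho `^ m * fnorm) ^+ 2.
Proof.
have [Cq Cq0 hq] := filtered_error_le.
have b0 : 0 < 2 * (c1 + 1 + c2) ^+ 2.
  by rewrite mulr_gt0 // exprn_gt0 //; move: hc1 hc2; lra.
exists (2 * Cq + 2 * (c1 + 1 + c2) ^+ 2); first by rewrite addr_gt0 // mulr_gt0.
move=> rho k hr; have /andP[r0 _] := hr.
apply: (energy_le mu1 hY) => [|L]; first exact: quasi_error_continuous.
apply: le_trans (quasi_error_energy_le k L hr) _.
apply: lerD.
  apply: le_trans (ler_wpM2l (ler0n R 2) (hq rho k L hr)) _.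
  rewrite [leLHS]mulrA (ler_wpM2r (sqr_ge0 _)) //.
  by rewrite lerDl ltW.
rewrite -[(c1 + 1 + c2) ^+ 2 * _ * _]mulrA -exprMn mulrA ler_wpM2r ?sqr_ge0 //.
by rewrite lerDr mulr_ge0 // ltW.
Qed.

(** Both sides are negative powers of rho^d N >= 1, with exponents sigma / d and 1/2, and sigma / d
    > 1/2. *)
Lemma powRN_ratio_le rho N : 0 < rho -> 1 <= rho ^+ d * N%:R :> R ->
  rho `^ (- sigma) * N%:R `^ (- (sigma / d%:R)) <=
  rho `^ (- (d%:R / 2)) * N%:R `^ (- 2^-1) :> R.
Proof.
move=> r0 h1; have rd : rho `^ d%:R = rho ^+ d := powR_mulrn d (ltW r0).
have e t : rho `^ (- (d%:R * t)) * N%:R `^ (- t) = (rho ^+ d * N%:R) `^ (- t) :> R.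
  rewrite (@powRM _ (rho ^+ d)) ?ler0n //; last by rewrite -rd powR_ge0.
  by rewrite -rd -powRrM mulrN.
have e1 : sigma = d%:R * (sigma / d%:R) by field; rewrite gt_eqF.
have le2 : 2^-1 <= sigma / d%:R by rewrite ler_pdivlMr //; move: hm hsigma; lra.
have -> : rho `^ (- sigma) = rho `^ (- (d%:R * (sigma / d%:R))) by rewrite -e1.
by rewrite !e ler_powR // lerN2.
Qed.

Lemma quasi_error_small (M : R) : 0 < M -> exists2 C4 : R, 0 < C4 &
  forall eps rho k, 0 < eps -> 0 < rho < rho0 -> 1 <= rho ^+ d * (n k)%:R ->
  C4 * (rho `^ m + rho `^ (- (d%:R / 2)) * (n k)%:R `^ (- 2^-1)) * (fnorm + M)
    <= eps / 2 ->
  I (fun y => quasi_error rho k y ^+ 2) <= (eps / 2) ^+ 2.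
Proof.
move=> M0; have [C C0 hC] := quasi_error_le.
have sC : 0 < Num.sqrt C by rewrite sqrtr_gt0.
have Mi : 0 < M^-1 by rewrite invr_gt0.
(* The sampling term r carries no norm of f; the summand M^-1 absorbs it through r = M^-1 * M *
   r. *)
exists (Num.sqrt C * (M^-1 + 1)); first by rewrite mulr_gt0 // addr_gt0.
move=> eps rho k e0 hr h1; have /andP[r0 _] := hr.
have F0 : 0 <= fnorm by exact: sqrtr_ge0.
have a0 : 0 <= rho `^ m by exact: powR_ge0.
have rr := powRN_ratio_le r0 h1.
have t0 : 0 <= rho `^ (- sigma) * (n k)%:R `^ (- (sigma / d%:R)).
  by rewrite mulr_ge0 ?powR_ge0.
set r := _ * (n k)%:R `^ (- 2^-1) in rr *.
have r0' : 0 <= r by exact: le_trans rr.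
move=> hcond; apply: le_trans (hC rho k hr) _.
set a := rho `^ m in a0 hcond *.
have h : Num.sqrt C * (r + a * fnorm) <= eps / 2.
  apply: le_trans hcond; rewrite -!mulrA ler_wpM2l ?(ltW sC) //.
  have -> : (M^-1 + 1) * ((a + r) * (fnorm + M)) =
      r * (M^-1 * M) + a * fnorm + M^-1 * (a + r) * fnorm + M^-1 * M * a + (a * M + r * fnorm + r * M).
    by ring.
  rewrite mulVf ?gt_eqF // mulr1 -2!addrA lerDl.
  have M1 := ltW Mi; have M2 := ltW M0; have ar := addr_ge0 a0 r0'.
  rewrite mul1r; exact: (addr_ge0 (mulr_ge0 (mulr_ge0 M1 ar) F0) (addr_ge0 a0
    (addr_ge0 (addr_ge0 (mulr_ge0 a0 M2) (mulr_ge0 r0' F0)) (mulr_ge0 r0' M2)))).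
have h2 : (Num.sqrt C * (r + a * fnorm)) ^+ 2 <= (eps / 2) ^+ 2.
  rewrite lerXn2r ?nnegrE ?divr_ge0 ?(ltW e0) //.
  by rewrite mulr_ge0 ?(ltW sC) // addr_ge0 // mulr_ge0.
apply: le_trans h2; rewrite [leRHS]exprMn sqr_sqrtr ?(ltW C0) // -mulrDr ler_wpM2l ?(ltW C0) //.
have h3 : (rho `^ (- sigma) * (n k)%:R `^ (- (sigma / d%:R))) ^+ 2 <= r ^+ 2.
  by rewrite lerXn2r ?nnegrE.
have h4 := mulr_ge0 r0' (mulr_ge0 a0 F0).
by rewrite [(r + _) ^+ 2]sqrrD; move: h3 h4; lra.
Qed.

(** * The noise and the final tail bound *)

Context (dT : measure_display) (T : measurableType dT) (P : probability T R).
Context (noise : forall k : nat, 'I_(n k) -> {RV P >-> R}).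
Context (M : R) (hM : 0 < M).
Hypotheses (hind : forall k, mutually_independent (@noise k))
  (hmean : forall k (j : 'I_(n k)), ('E_P[noise j] = 0)%E)
  (hbound : forall k (j : 'I_(n k)), {ae P, forall w, `|noise j w| <= M}).

Definition noise_profile rho k (j : 'I_(n k)) (y : V) : R :=
  (n k)%:R^-1 * K rho y (x j).

Definition noise_gram rho k (a b : 'I_(n k)) : R :=
  I (fun y => noise_profile rho a y * noise_profile rho b y).

Lemma noise_profile_continuous rho k (j : 'I_(n k)) : 0 < rho ->
  sphere_continuous (noise_profile rho j).
Proof. by move=> r0; apply: sphere_continuousZ; exact: zonal_kernel_continuous. Qed.

Lemma noise_errorE rho k (e : 'I_(n k) -> R) y :
  noisy_quasi_interpolant (K rho) (@x k) e f y - f y =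
  quasi_error rho k y + \sum_j e j * noise_profile rho j y.
Proof.
have -> : \sum_j e j * noise_profile rho j y =
    (n k)%:R^-1 * \sum_j e j * K rho y (x j).
  by rewrite mulr_sumr; apply: eq_bigr => j _; rewrite /noise_profile mulrCA.
rewrite /quasi_error /noisy_quasi_interpolant addrAC -mulrDr -big_split /=.
congr (_ * _ - _); apply: eq_bigr => j _; ring.
Qed.

Lemma qform_noise_gram rho k (v : 'I_(n k) -> R) : 0 < rho ->
  qform (@noise_gram rho k) v = I (fun y => (\sum_j v j * noise_profile rho j y) ^+ 2).
Proof.
move=> r0; have cg j := @noise_profile_continuous rho k j r0.
have -> : (fun y => (\sum_j v j * noise_profile rho j y) ^+ 2) =
    (fun y => \sum_a \sum_b v a * v b * (noise_profile rho a y * noise_profile rho b y)).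
  apply/funext => y; rewrite expr2 mulr_suml; apply: eq_bigr => a _.
  by rewrite mulr_sumr; apply: eq_bigr => b _; rewrite mulrACA.
have c2' a b : sphere_continuous (fun y =>
    v a * v b * (noise_profile rho a y * noise_profile rho b y)).
  by apply: sphere_continuousZ; exact: sphere_continuousM.
rewrite sphere_integral_sum // => [|a]; last exact: sphere_continuous_sum.
apply: eq_bigr => a _; rewrite sphere_integral_sum //; apply: eq_bigr => b _.
by rewrite sphere_integralZ //; exact: sphere_continuousM.
Qed.

Lemma noise_gram_diag_le : exists2 B : R, 0 < B &
  forall rho k (j : 'I_(n k)), 0 < rho < rho0 ->
  noise_gram rho j j <= B * (n k)%:R^-1 ^+ 2 * rho^-1 ^+ d.
Proof.
have [Bk Bk0 hBk] := zonal_kernel_diag_le.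
have c40 : 0 < 1 + c4 by move: hc3 hc34; lra.
exists ((1 + c4) * Bk); first exact: mulr_gt0.
move=> rho k j hr; have /andP[r0 _] := hr.
have cK y : S y -> sphere_continuous ((K rho)^~ y).
  by move=> Sy; exact: zonal_kernel_continuous.
have Kd y : S y -> K rho y y = K rho (x j) (x j) by move=> Sy; apply: zonal_kernel_diag.
have -> : noise_gram rho j j = (n k)%:R^-1 ^+ 2 * I (fun y => K rho y (x j) ^+ 2).
  rewrite -sphere_integralZ; last by apply: sphere_continuousM; exact: cK.
  by congr (I _); apply/funext => y; rewrite -expr2 exprMn.
have h : I (fun y => K rho y (x j) ^+ 2) <= (1 + c4) * K rho (x j) (x j).
  apply: (kernel_energy_le mu1 hY cK Kd (hphihat hr)) => // l.
    exact: phihat_ge0.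
  exact: phihat_le_cst.
apply: le_trans (ler_wpM2l (sqr_ge0 _) h) _.
apply: le_trans (ler_wpM2l (sqr_ge0 _) (ler_wpM2l (ltW c40) (hBk rho (x j) hr (xS j)))) _.
by rewrite le_eqVlt; apply/orP; left; apply/eqP; ring.
Qed.

(** Writes the error norm as the square root of a polynomial in the noise values, which makes the
    error event measurable. *)
Lemma noise_L2normE rho k (e : 'I_(n k) -> R) : 0 < rho ->
  L2norm mu (fun y => noisy_quasi_interpolant (K rho) (@x k) e f y - f y)%R =
  (Num.sqrt (I (fun y => quasi_error rho k y ^+ 2) +
     \sum_j e j * (2 * I (fun y => quasi_error rho k y * noise_profile rho j y)) +
     qform (@noise_gram rho k) e))%:E.
Proof.
move=> r0; have cg j := @noise_profile_continuous rho k j r0.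
have cD := @quasi_error_continuous rho k r0.
have cS : sphere_continuous (fun y => \sum_j e j * noise_profile rho j y).
  by apply: sphere_continuous_sum => j; exact: sphere_continuousZ.
have -> : (fun y => noisy_quasi_interpolant (K rho) (@x k) e f y - f y) =
    (fun y => quasi_error rho k y + \sum_j e j * noise_profile rho j y).
  by apply/funext => y; exact: noise_errorE.
rewrite L2normE; last exact: sphere_continuousD.
have cDg (j : 'I_(n k)) : sphere_continuous (fun y => quasi_error rho k y * noise_profile rho j y).
  exact: sphere_continuousM.
have c2Dg j := @sphere_continuousZ _ _ (2 * e j) _ (cDg j).
have cD2 : sphere_continuous (fun y => quasi_error rho k y ^+ 2) by exact: sphere_continuousM.
have cS2 : sphere_continuous (fun y => (\sum_j e j * noise_profile rho j y) ^+ 2).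
  exact: sphere_continuousM.
have cX : sphere_continuous (fun y =>
    \sum_j (2 * e j) * (quasi_error rho k y * noise_profile rho j y)).
  exact: sphere_continuous_sum.
congr ((Num.sqrt _)%:E); rewrite qform_noise_gram //.
have -> : \sum_j e j * (2 * I (fun y => quasi_error rho k y * noise_profile rho j y)) =
    I (fun y => \sum_j (2 * e j) * (quasi_error rho k y * noise_profile rho j y)).
  rewrite sphere_integral_sum //; apply: eq_bigr => j _; rewrite sphere_integralZ //; ring.
rewrite -sphere_integralD // -sphere_integralD //; last exact: sphere_continuousD.
congr (I _); apply/funext => y; rewrite sqrrD; congr (_ + _ + _).
rewrite -mulr_natl mulrA mulr_sumr.
by apply: eq_bigr => j _; ring.
Qed.

Lemma measurable_noise_event rho k (eps : R) : 0 < rho ->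
  measurable [set w | eps%:E <= L2norm mu (fun y =>
    noisy_quasi_interpolant (K rho) (@x k) (fun j => noise j w) f y - f y)%R]%E.
Proof.
move=> r0.
have -> : [set w | eps%:E <= L2norm mu (fun y =>
      noisy_quasi_interpolant (K rho) (@x k) (fun j => noise j w) f y - f y)%R]%E =
    [set w | (eps <= Num.sqrt (I (fun y => quasi_error rho k y ^+ 2) +
     \sum_(j < n k) noise j w * (2 * I (fun y => quasi_error rho k y * noise_profile rho j y)) +
     qform (@noise_gram rho k) (fun j => noise j w)))%R].
  by apply/seteqP; split => w /=; rewrite noise_L2normE // lee_fin.
have mX (j : 'I_(n k)) : measurable_fun setT (noise j : T -> R) by exact: measurable_funP.
rewrite -[X in measurable X]setTI; apply: measurable_fun_le => //.
apply: measurableT_comp; first exact: (continuous_measurable_fun (@sqrt_continuous R)).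
apply: measurable_funD; last exact: (measurable_qform (@noise_gram rho k) mX).
apply: measurable_funD => //; apply: measurable_sum => j.
exact: measurable_funM.
Qed.

(** From |D + S|^2 <= 2 |D|^2 + 2 |S|^2: a bias of at most eps / 2 takes eps^2 / 2, leaving 2 (eps /
    2)^2 for the noise. *)
Lemma noise_event_sub rho k (eps : R) w : 0 < rho -> 0 < eps ->
  I (fun y => quasi_error rho k y ^+ 2) <= (eps / 2) ^+ 2 ->
  (eps%:E <= L2norm mu (fun y =>
    noisy_quasi_interpolant (K rho) (@x k) (fun j => noise j w) f y - f y)%R)%E ->
  (eps / 2) ^+ 2 <= qform (@noise_gram rho k) (fun j => noise j w).
Proof.
move=> r0 e0 hD; pose e (j : 'I_(n k)) := noise j w : R.
have cS : sphere_continuous (fun y => \sum_(j < n k) e j * noise_profile rho j y).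
  apply: sphere_continuous_sum => j; apply: sphere_continuousZ.
  exact: noise_profile_continuous.
have cD := @quasi_error_continuous rho k r0.
have -> : (fun y => noisy_quasi_interpolant (K rho) (@x k) (fun j => noise j w) f y - f y) =
    (fun y => quasi_error rho k y + \sum_(j < n k) e j * noise_profile rho j y).
  by apply/funext => y; exact: noise_errorE.
have cDS : sphere_continuous (fun y => quasi_error rho k y + \sum_(j < n k) e j * noise_profile rho j y).
  exact: sphere_continuousD.
have cD2 : sphere_continuous (fun y => quasi_error rho k y ^+ 2) by exact: sphere_continuousM.
have cS2 : sphere_continuous (fun y => (\sum_(j < n k) e j * noise_profile rho j y) ^+ 2).
  exact: sphere_continuousM.
rewrite (L2normE _ cDS) lee_fin qform_noise_gram // => h.
have h2 : eps ^+ 2 <= I (fun y => (quasi_error rho k y + \sum_(j < n k) e j * noise_profile rho j y) ^+ 2).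
  rewrite -[leRHS]sqr_sqrtr; first by rewrite lerXn2r ?nnegrE ?sqrtr_ge0 // ltW.
  by apply: sphere_integral_ge0 => y _; exact: sqr_ge0.
have h3 : I (fun y => (quasi_error rho k y + \sum_(j < n k) e j * noise_profile rho j y) ^+ 2) <=
    I (fun y => 2 * quasi_error rho k y ^+ 2 + 2 * (\sum_(j < n k) e j * noise_profile rho j y) ^+ 2).
  apply: sphere_integral_le => [||y _].
  - exact: sphere_continuousM.
  - by apply: sphere_continuousD; exact: sphere_continuousZ.
  by have := sqr_ge0 (quasi_error rho k y - \sum_(j < n k) e j * noise_profile rho j y); nra.
move: h3; rewrite sphere_integralD; [|exact: sphere_continuousZ|exact: sphere_continuousZ].
rewrite !sphere_integralZ // => h3.
by move: h2 h3 hD; rewrite /e; nra.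
Qed.

Lemma noise_event_tail : exists2 c : R, 0 < c &
  forall eps rho k, 0 < eps -> 0 < rho < rho0 ->
  I (fun y => quasi_error rho k y ^+ 2) <= (eps / 2) ^+ 2 ->
  (P [set w | eps%:E <= L2norm mu (fun y =>
     noisy_quasi_interpolant (K rho) (@x k) (fun j => noise j w) f y - f y)%R]
   <= (2 * expR (- (c * rho ^+ d * (n k)%:R * eps ^+ 2 * M ^- 2)))%:E)%E.
Proof.
have [B B0 hB] := noise_gram_diag_le.
(* Here 192 = 48 * 4: the constant of [qform_tail] times the 4 from the threshold (eps / 2)^2. *)
exists (192 * B)^-1; first by rewrite invr_gt0 mulr_gt0.
move=> eps rho k e0 hr hD; have /andP[r0 _] := hr.
have nk : (0 < n k)%N by case: hx.
have nk0 : 0 < (n k)%:R :> R by rewrite ltr0n.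
pose g := B * (n k)%:R^-1 ^+ 2 * rho^-1 ^+ d.
have g0 : 0 < g by rewrite !mulr_gt0 ?exprn_gt0 ?invr_gt0.
have -> : (192 * B)^-1 * rho ^+ d * (n k)%:R * eps ^+ 2 * M ^- 2 =
    (eps / 2) ^+ 2 / (48 * (n k)%:R * M ^+ 2 * g).
  have rd : rho ^+ d != 0 by rewrite gt_eqF // exprn_gt0.
  rewrite /g [rho^-1 ^+ d]exprVn; move: (rho ^+ d) rd => r rd; field.
  by rewrite rd !gt_eqF.
have mX (j : 'I_(n k)) : measurable_fun setT (noise j : T -> R) by exact: measurable_funP.
apply: le_trans (qform_tail_ae _ nk hM g0 _ _ _ (@hind k) (@hmean k) (@hbound k)).
- apply: le_measure; rewrite ?inE.
  + exact: measurable_noise_event.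
  + rewrite -[X in measurable X]setTI; apply: measurable_fun_le => //.
    exact: (measurable_qform (@noise_gram rho k) mX).
  by move=> w /=; exact: noise_event_sub.
- by move=> a b; rewrite /noise_gram; congr (I _); apply/funext => y; rewrite mulrC.
- by move=> u; rewrite qform_noise_gram //; apply: sphere_integral_ge0 => y _; exact: sqr_ge0.
- move=> j; rewrite hB // andbT; apply: sphere_integral_ge0 => y _.
  by rewrite -expr2 sqr_ge0.
Qed.

Lemma noisy_quasi_interpolation_tail : exists2 C4 : R, 0 < C4 &
  forall eps : R, 0 < eps ->
  exists2 C : R, 0 < C &
  forall (rho : R) (k : nat), 0 < rho < rho0 ->
    C4 * (rho `^ m + rho `^ (- (d%:R / 2)) * (n k)%:R `^ (- 2^-1))
       * (fnorm + M) <= eps / 2 ->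
    (P [set w | eps%:E <= L2norm mu (fun y =>
       noisy_quasi_interpolant (K rho) (@x k) (fun j => noise j w) f y - f y)%R]
     <= (2 * expR (- (C * rho ^+ d * (n k)%:R * eps ^+ 2 * M ^- 2)))%:E)%E.
Proof.
have [c c0 tail] := noise_event_tail.
have [C4 C40 small] := quasi_error_small hM.
exists C4 => // eps e0.
(* The second entry keeps the exponent at most 1/2 when rho^d N < 1, and then 2 exp (-1/2) >= 2 (1 -
   1/2) = 1. *)
pose C := Num.min c (M ^+ 2 / (2 * eps ^+ 2)).
have C0 : 0 < C by rewrite lt_min c0 divr_gt0 ?mulr_gt0 ?exprn_gt0.
exists C => // rho k hr hcond; have /andP[r0 _] := hr.
have M2 : 0 < M ^+ 2 by rewrite exprn_gt0.
have e2 : 0 < eps ^+ 2 by rewrite exprn_gt0.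
have rd : 0 < rho ^+ d by rewrite exprn_gt0.
have [h1|h1] := leP 1 (rho ^+ d * (n k)%:R).
  apply: le_trans (tail eps rho k e0 hr (small eps rho k e0 hr h1 hcond)) _.
  rewrite lee_fin ler_wpM2l // ler_expR lerN2.
  have p0 : 0 <= rho ^+ d * ((n k)%:R * (eps ^+ 2 * M ^- 2)).
    apply: mulr_ge0 (ltW rd) (mulr_ge0 (ler0n _ _) (mulr_ge0 (ltW e2) _)).
    by rewrite invr_ge0 ltW.
  have Cc : C <= c by rewrite /C ge_min lexx.
  have e t : t * rho ^+ d * (n k)%:R * eps ^+ 2 * M ^- 2 =
      t * (rho ^+ d * ((n k)%:R * (eps ^+ 2 * M ^- 2))) by rewrite -!mulrA.
  by rewrite !e; exact: ler_wpM2r p0 _ _ Cc.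
(* Too few points for the tail bound: the right-hand side is then at least 1. *)
apply: le_trans (probability_le1 P (measurable_noise_event k eps r0)) _.
have hC : C * rho ^+ d * (n k)%:R * eps ^+ 2 * M ^- 2 <= 2^-1.
  have hC1 : C <= M ^+ 2 / (2 * eps ^+ 2) by rewrite /C ge_min lexx orbT.
  have -> : C * rho ^+ d * (n k)%:R * eps ^+ 2 * M ^- 2 =
      (rho ^+ d * (n k)%:R) * (C * (eps ^+ 2 * M ^- 2)) by ring.
  have e3 : 0 <= eps ^+ 2 * M ^- 2 by rewrite ltW // divr_gt0.
  have hC2 : C * (eps ^+ 2 * M ^- 2) <= 2^-1.
    apply: le_trans (ler_wpM2r e3 hC1) _.
    rewrite le_eqVlt; apply/orP; left; apply/eqP; field.
    by rewrite !gt_eqF.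
  have p0 : 0 <= rho ^+ d * (n k)%:R by rewrite mulr_ge0 // ltW.
  have C5 := mulr_ge0 (ltW C0) e3.
  by move: hC2 p0 C5 h1; set u := C * _; set v := rho ^+ d * _; nra.
rewrite lee_fin; have := expR_ge1Dx (- (C * rho ^+ d * (n k)%:R * eps ^+ 2 * M ^- 2)).
by move: hC; lra.
Qed.

End Approximation.

Theorem theorem5p1 (R : realType) (d : nat) (hd : (0 < d)%N)
  (mu : probability (borel_rV R d.+1) R) (hmu : uniform_on_sphere mu)
  (Z : nat -> nat) (Y : forall l : nat, 'I_(Z l) -> 'rV[R]_d.+1 -> R)
  (hY : spherical_harmonic_basis mu Y)
  (sigma m s rho0 : R)
  (hm : d%:R / 2 < m) (hsigma : m <= sigma) (hs : sigma <= s)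
  (hrho0 : 0 < rho0 < 1)
  (phi : R -> R) (hphi : continuous_on_0_infty phi)
  (* phihat rho l is the l-th Fourier-Legendre coefficient of varphi_rho *)
  (phihat : R -> nat -> R)
  (hphihat : forall rho : R, 0 < rho < rho0 ->
     fourier_legendre Y (zonal_kernel mu phi rho) (phihat rho))
  (c1 c2 c3 c4 : R) (hc1 : 0 < c1) (hc2 : 0 < c2) (hc3 : 0 < c3)
  (hc34 : c3 <= c4)
  (hi : forall rho : R, 0 < rho < rho0 ->
     forall l : nat, (l%:Z <= Num.floor (rho^-1 - 1)) ->
       `|1 - phihat rho l| <= c1 * l%:R `^ m * rho `^ m)
  (hii : forall rho : R, 0 < rho < rho0 ->
     forall l : nat, (Num.floor (rho^-1 - 1) < l%:Z) -> phihat rho l <= c2)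
  (hiii : forall rho : R, 0 < rho < rho0 ->
     forall l : nat, (0 < l)%N ->
       c3 * (1 + rho * l%:R) `^ (- (2 * s)) <= phihat rho l
       <= c4 * (1 + rho * l%:R) `^ (- (2 * s)))
  (f : 'rV[R]_d.+1 -> R) (hf : in_sobolev mu Y sigma f)
  (n : nat -> nat) (x : forall k : nat, 'I_(n k) -> 'rV[R]_d.+1)
  (hx : QMC_design mu Y sigma x)
  (dT : measure_display) (T : measurableType dT) (P : probability T R)
  (noise : forall k : nat, 'I_(n k) -> {RV P >-> R})
  (M : R) (hM : 0 < M)
  (hind : forall k, mutually_independent (noise k))
  (hmean : forall k (j : 'I_(n k)), ('E_P[noise k j] = 0)%E)
  (hbound : forall k (j : 'I_(n k)), {ae P, forall w, `|noise k j w| <= M}) :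
  exists2 C4 : R, 0 < C4 &
  forall eps : R, 0 < eps ->
  exists2 C : R, 0 < C &
  forall (rho : R) (k : nat), 0 < rho < rho0 ->
    C4 * (rho `^ m + rho `^ (- (d%:R / 2)) * (n k)%:R `^ (- 2^-1))
       * (sobolev_norm mu Y sigma f + M) <= eps / 2 ->
    (P [set w | eps%:E <=
          L2norm mu (fun y =>
            noisy_quasi_interpolant (zonal_kernel mu phi rho) (x k)
              (fun j => noise k j w) f y - f y)%R]
     <= (2 * expR (- (C * rho ^+ d * (n k)%:R * eps ^+ 2 * M ^- 2)))%:E)%E.
Proof.
exact: (noisy_quasi_interpolation_tail hd hmu hY hm hsigma hs hrho0 hphi hphihat
  hc1 hc2 hc3 hc34 hi hii hiii hf hx hM hind hmean hbound).
Qed.
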